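(* Let $\mathbb L\subseteq\mathbb T_N$ be a sub-interval with $|\mathbb L|\lesssim N^{1/3+\varepsilon_{\mathrm{reg}}}$. Suppose $\{\mathfrak f_i\}_{i=1}^n$ is a collection of functions $\{\pm1\}^{\mathbb L}\to\mathbb R$ such that: (1) for every $i$, $\mathbb E^{\sigma,\mathbb L}\mathfrak f_i=0$ for all $\sigma\in[-1,1]$, and $\sup_i|\mathfrak f_i[\eta]|\lesssim1$ for all $\eta\in\{\pm1\}^{\mathbb L}$; (2) there exist pairwise disjoint sub-intervals $\{\mathbb I_i\}_{i=1}^n$ of $\mathbb L$ such that $\mathfrak f_i[\eta]$ depends only on $\eta_z$ for $z\in\mathbb I_i$. Fix $0<\tau\lesssim N^{-4/3}$, and assume that the distribution of $\eta^{\mathbb L}_s$ at time $s=0$ is $\mathbb P^{\sigma,\mathbb L}$ for some $\sigma\in[-1,1]$. Then for any $\delta>0$, $$\mathbb E\left(\left\{\tau^{-1}\int_0^\tau\frac1n\sum_{i=1}^n\mathfrak f_i[\eta^{\mathbb L}_s]\,\mathrm ds\right\}^2\right)\lesssim_\delta N^{\delta}N^{-2}\tau^{-1}n^{-1}\sup_{i=1,\dots,n}|\mathbb I_i|^2 .$$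
   Context: $a\lesssim b$ means $|a|\le Cb$ with $C$ independent of $N$; in $\lesssim_\delta$ the constant may also depend on $\delta$. $\varepsilon_{\mathrm{reg}}>0$ is a fixed small constant independent of $N$. $\mathbb T_N=\mathbb Z/N\mathbb Z$; a sub-interval is a set of the form $\{x,x+1,\dots,x+\mathfrak l\}$, $\mathfrak l\ge0$. The sub-interval $\mathbb L=y+\{-\ell,\dots,\ell\}$ has length $2\ell+1$ with $\ell=N^\upsilon$, $0<\upsilon\le1/3+\beta$ ($\beta>0$ small, fixed), and is treated as a torus with its own periodic boundary conditions ($y+\ell+1=y-\ell$); additions involving points of $\mathbb L$ are taken on this torus. Let $\mathfrak d$ be a fixed uniformly bounded local function of spin configurations ($\mathfrak d[\eta]$ depends only on $\eta_x$ for $x$ in a neighborhood of $0$ of size independent of $N$). Let $(\tau_x\eta)_z=\eta_{x+z}$, and $\mathscr L_x\mathfrak f[\eta]=\mathfrak f[\eta^{x,x+1}]-\mathfrak f[\eta]$, where $\eta^{x,x+1}$ is $\eta$ with $\eta_x,\eta_{x+1}$ swapped. The process $t\mapsto\eta^{\mathbb L}_t\in\{\pm1\}^{\mathbb L}$ is the Markov process with generator $$\mathscr L^{\mathbb L}_N=\tfrac12N^2\sum_{x\in\mathbb L}\mathscr L_x+\tfrac12N^{3/2}\sum_{x\in\mathbb L}\big(\mathbf 1_{\eta_x=-1,\eta_{x+1}=1}-\mathbf 1_{\eta_x=1,\eta_{x+1}=-1}\big)\big(1+N^{-1/2}\mathfrak d[\tau_x\eta]\big)\mathscr L_x .$$ For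 $\mathbb I\subseteq\mathbb T_N$ and $\sigma\in[-1,1]$ (for which the set is non-empty), $\mathbb P^{\sigma,\mathbb I}$ is the uniform measure on $\{\eta\in\{\pm1\}^{\mathbb I}:|\mathbb I|^{-1}\sum_{x\in\mathbb I}\eta_x=\sigma\}$ and $\mathbb E^{\sigma,\mathbb I}$ its expectation. *)

(* Defs.v *)
From HB Require Import structures.
From mathcomp Require Import all_boot all_order all_algebra all_fingroup.
From mathcomp Require Import all_classical all_reals all_analysis.

Set Implicit Arguments.
Unset Strict Implicit.
Unset Printing Implicit Defensive.

Import Order.TTheory GRing.Theory Num.Theory.
Import numFieldNormedType.Exports.

Local Open Scope classical_set_scope.
Local Open Scope ring_scope.

(** A sub-interval {y, ..., y + l} of Z/N (l < N), with its own periodic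
    boundary conditions, is identified with the cyclic group 'I_l.+1 through
    k |-> y + k.  The group law of 'I_l.+1 is addition modulo l + 1; [step l]
    is the class of 1, so that [x + step l *~ z] is the site x + z. *)
Definition step (l : nat) : 'I_l.+1 := inZp 1.

(** Spins are booleans: [true] stands for +1 and [false] for -1. *)
Definition spin (R : realType) (b : bool) : R := if b then 1 else -1.

Notation config l := {ffun 'I_l.+1 -> bool}.

(** {x, ..., x + k}, wrapping around the torus when necessary. *)
Definition is_subinterval (l : nat) (I : {set 'I_l.+1}) : Prop :=
  exists (x : 'I_l.+1) (k : nat), I = [set x + step l *+ nat_of_ord j | j : 'I_k.+1]%SET.

Definition swap_spins (l : nat) (x : 'I_l.+1) (eta : config l) : config l :=
  [ffun z => eta (tperm x (x + step l) z)].

Definition bond_gen (R : realType) (l : nat) (x : 'I_l.+1)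
    (F : config l -> R) (eta : config l) : R :=
  F (swap_spins x eta) - F eta.

(** The configuration tau_x eta, read along the torus as a (periodic)
    configuration on the integers. *)
Definition shift_config (l : nat) (x : 'I_l.+1) (eta : config l) : int -> bool :=
  fun z => eta (x + step l *~ z).

Definition local_fun (R : realType) (d : (int -> bool) -> R) : Prop :=
  exists r : nat, forall eta eta' : int -> bool,
    (forall z : int, (`|z|%N <= r)%N -> eta z = eta' z) -> d eta = d eta'.

Definition uniformly_bounded (R : realType) (d : (int -> bool) -> R) : Prop :=
  exists B : R, forall eta, `|d eta| <= B.

Definition generator (R : realType) (N l : nat) (d : (int -> bool) -> R)
    (F : config l -> R) (eta : config l) : R :=
  2^-1 * N%:R ^+ 2 * (\sum_(x : 'I_l.+1) bond_gen x F eta) +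
  2^-1 * N%:R `^ (3 / 2) *
    \sum_(x : 'I_l.+1)
      ((~~ eta x && eta (x + step l))%:R - (eta x && ~~ eta (x + step l))%:R) *
      (1 + N%:R `^ (- (1 / 2)) * d (shift_config x eta)) * bond_gen x F eta.

Definition hyperplane (R : realType) (l : nat) (sigma : R) : {set config l} :=
  [set eta : config l |
    (l.+1%:R)^-1 * (\sum_(x : 'I_l.+1) spin R (eta x)) == sigma]%SET.

Definition canonical_pmf (R : realType) (l : nat) (sigma : R) (eta : config l) : R :=
  (eta \in hyperplane l sigma)%:R / #|hyperplane l sigma|%:R.

Definition canonical_expectation (R : realType) (l : nat) (sigma : R)
    (F : config l -> R) : R :=
  \sum_(eta : config l) canonical_pmf sigma eta * F eta.

(** [p t a b] is the probability of going from a to b in time t. *)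
Record transition_function (R : realType) (S : finType) (p : R -> S -> S -> R)
    : Prop := TransitionFunction {
  tf_ge0 : forall t a b, 0 <= t -> 0 <= p t a b ;
  tf_sum1 : forall t a, 0 <= t -> \sum_(b : S) p t a b = 1 ;
  tf_0 : forall a b, p 0 a b = (a == b)%:R ;
  tf_chapman_kolmogorov : forall s t a c, 0 <= s -> 0 <= t ->
    p (s + t) a c = \sum_(b : S) p s a b * p t b c }.

Definition has_generator (R : realType) (S : finType) (p : R -> S -> S -> R)
    (L : (S -> R) -> S -> R) : Prop :=
  forall (F : S -> R) (a : S),
    h^-1 * ((\sum_(b : S) p h a b * F b) - F a) @[h --> 0^'+] --> L F a.

Definition natural_filtration (R : realType) (disp : measure_display)
    (T : measurableType disp) (S : finType) (X : R -> T -> S) (t : R)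
    : set (set T) :=
  <<s [set A | exists (r : R) (a : S),
         [/\ 0 <= r, r <= t & A = [set w | X r w = a]] ] >>.

Definition cadlag (R : realType) (S : Type) (x : R -> S) : Prop :=
  (forall t, 0 <= t -> \forall s \near t^'+, x s = x t) /\
  (forall t, 0 < t -> exists a : S, \forall s \near t^'-, x s = a).

(** Only the times t >= 0 matter. *)
Definition markov_process (R : realType) (disp : measure_display)
    (T : measurableType disp) (P : probability T R) (S : finType)
    (L : (S -> R) -> S -> R) (X : R -> T -> S) : Prop :=
  [/\ forall t a, 0 <= t -> measurable [set w | X t w = a],
      forall w, cadlag (X ^~ w) &
      exists p : R -> S -> S -> R,
        [/\ transition_function p, has_generator p L &
            forall (s h : R) (A : set T) (a b : S), 0 <= s -> 0 <= h ->
              natural_filtration X s A ->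
              P (A `&` [set w | X s w = a] `&` [set w | X (s + h) w = b]) =
              (P (A `&` [set w | X s w = a]) * (p h a b)%:E)%E]].

(* Main.v *)
(** Write [<phi>] for the canonical average, [F] for the average of the [f_i],
    [e] for the number of sites and [L] for the generator, whose part containing
    [d] has size [N] and does not preserve the canonical measure.

    - The spectral gap of exchanges inside an interval [I] is of order [|I|^-2]
      (Bernoulli-Laplace gap plus path comparison).  As the [I_i] are disjoint,
      [<F u>^2 <= b2 * sum_x <(u(eta^{x,x+1}) - u(eta))^2>] with
      [b2 = K^2 max |I_i|^2 / n].
    - The symmetric part of [L] absorbs the [d]-part at the cost of [B^2 e <u^2>],
      and [e tau] is bounded.  Hence [V_t = int_0^t P_s F ds] satisfies
      [<V_t^2> <= C tau b2 / N^2] and [int_0^tau <F V_t> dt <= C tau b2 / N^2].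
    - The law at time [t] has density [1 + k_t], and the same absorption applied to
      [<k_t^4>] gives [<k_t^4> <= C (e tau)^2].
    - The second moment of [int_0^tau F] is [2 int_0^tau <(1 + k_t) F V_{tau - t}> dt],
      and [<k F V>^4 <= <k^4> <F^4> <V^2>^2] with [<F^4> <= K^4 / n] is small enough
      because [n <= e] and [e^3 tau^4 N^4] is bounded as soon as [ereg <= 1/9].

    Time is discretised: [P_h = 1 + h L + o(h)] is all that is used about the
    semigroup, and the time integral of a cadlag path is a limit of Riemann sums. *)

Require Import Defs.
From HB Require Import structures.
From mathcomp Require Import all_boot all_order all_algebra all_fingroup.
From mathcomp Require Import all_classical all_reals all_analysis.
From mathcomp Require Import measurable_realfun ring lra zify.

Set Implicit Arguments.
Unset Strict Implicit.
Unset Printing Implicit Defensive.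

Import Order.TTheory GRing.Theory Num.Theory.
Import numFieldNormedType.Exports.

Local Open Scope ring_scope.

(** * The Bernoulli-Laplace spectral gap *)

(** The centring hypothesis concerns the whole torus, whereas the gap is used inside each [I i] with
    the other spins frozen. The link is that a function of the spins of [I i] alone, with zero sum
    on every particle-number level of the torus, also has zero sum once the exterior spins and the
    particle number in [I i] are fixed. The same fact makes different blocks orthogonal and gives
    both factors 1/n. Since the measure is not invariant, two-time correlations depend on more than
    the lag. Writing the law as 1 + k_t separates a part that looks stationary, where dissipation
    yields the bound, from a correction for which size is enough. Dissipation controls V only in
    L^2, so k F has to be in L^2, and hence k and F in L^4: this is why the fourth moment of k is
    propagated. The time step is chosen last and may depend on N, l and the functions. All errors
    beyond first order are therefore absorbed in a term [h * s], with [s] of the size of the bound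
    sought, and leave no trace in the constants. *)

Section BernoulliLaplace.
Variables (R : realFieldType) (T : finType).
Notation conf := {ffun T -> bool}.
Implicit Types (eta zeta : conf) (h g : conf -> R) (I : {set T}).

Definition xchg (x y : T) (eta : conf) : conf := [ffun z => eta (tperm x y z)].
Definition flip (x : T) (eta : conf) : conf := [ffun z => eta z (+) (z == x)].

Lemma xchgK x y : involutive (xchg x y).
Proof. by move=> eta; apply/ffunP=> z; rewrite !ffunE tpermK. Qed.

Lemma flipK x : involutive (flip x).
Proof. by move=> eta; apply/ffunP=> z; rewrite !ffunE addbK. Qed.

Lemma xchgC x y : xchg x y =1 xchg y x.
Proof. by move=> eta; apply/ffunP=> z; rewrite !ffunE tpermC. Qed.

Lemma xchg_id x y eta : eta x = eta y -> xchg x y eta = eta.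
Proof. by move=> e; apply/ffunP=> z; rewrite !ffunE; case: tpermP => [->|->|]. Qed.

Lemma flip_flip x y eta : eta x != eta y -> flip y (flip x eta) = xchg x y eta.
Proof.
move=> ne; apply/ffunP=> z; rewrite !ffunE; case: tpermP => [->|->|].
- have /negbTE-> : x != y by apply: contraNneq ne => ->.
  by rewrite eqxx; move: ne; case: (eta x); case: (eta y).
- have /negbTE-> : y != x by apply: contraNneq ne => ->.
  by rewrite eqxx; move: ne; case: (eta x); case: (eta y).
- by move=> /eqP/negbTE-> /eqP/negbTE->; rewrite !addbF.
Qed.

Definition cnt I eta : nat := #|[set x in I | eta x]|.

Definition outside_eq I eta zeta : bool :=
  [forall z, (z \notin I) ==> (eta z == zeta z)].

Definition centred I h : Prop := forall zeta (m : nat),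
  \sum_(eta | outside_eq I eta zeta && (cnt I eta == m)) h eta = 0.

(** The sl2 ladder operators on functions of the spins in [I]: [lower] carries functions supported
    on m + 1 particles to functions supported on m, and [raise] is its adjoint for the counting
    measure. *)
Definition lower I h eta : R := \sum_(x in I | ~~ eta x) h (flip x eta).
Definition raise I h eta : R := \sum_(x in I | eta x) h (flip x eta).

Lemma sum_xchg x y h : \sum_eta h (xchg x y eta) = \sum_eta h eta.
Proof. by rewrite [RHS](reindex_inj (inv_inj (@xchgK x y))). Qed.

Lemma lower_adj I h g : \sum_eta lower I h eta * g eta = \sum_eta h eta * raise I g eta.
Proof.
rewrite /lower /raise.
under eq_bigr do rewrite mulr_suml big_mkcondr.
under [RHS]eq_bigr do rewrite mulr_sumr big_mkcondr.
rewrite exchange_big [RHS]exchange_big; apply: eq_bigr => x xI.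
rewrite [LHS](reindex_inj (inv_inj (@flipK x))) /=; apply: eq_bigr => eta _.
by rewrite flipK !ffunE eqxx addbT negbK.
Qed.

(** The off-diagonal part shared by [raise lower] and [lower raise]; it cancels in their
    commutator. *)
Definition mixed I h eta : R := \sum_(x in I | eta x) \sum_(y in I | ~~ eta y) h (xchg x y eta).

Lemma flip_at x eta : flip x eta x = ~~ eta x.
Proof. by rewrite ffunE eqxx addbT. Qed.
Lemma flip_away x y eta : y != x -> flip x eta y = eta y.
Proof. by move=> /negbTE yx; rewrite ffunE yx addbF. Qed.

(** Flipping the same site twice restores [eta] and gives the diagonal term; two different sites
    exchange a particle with a hole. *)
Lemma raise_lower I h eta :
  raise I (lower I h) eta = (cnt I eta)%:R * h eta + mixed I h eta.
Proof.
rewrite /raise /mixed /lower.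
have -> : (cnt I eta)%:R * h eta = \sum_(x in I | eta x) h eta.
  rewrite sumr_const mulr_natl; congr (_ *+ _).
  by apply: eq_card => x; rewrite !inE.
rewrite -big_split /=; apply: eq_bigr => x /andP[xI ex].
rewrite (bigD1 x) ?flip_at ?ex ?xI //= flipK; congr (_ + _).
rewrite [LHS]big_mkcond [RHS]big_mkcond /=; apply: eq_bigr => y _.
have [->|yx] := eqVneq y x; first by rewrite ex !andbF.
rewrite flip_away // andbT; case: ifP => // /andP[_ ey].
by rewrite flip_flip // ex (negbTE ey).
Qed.

Lemma lower_raise I h eta :
  lower I (raise I h) eta = (#|I| - cnt I eta)%:R * h eta + mixed I h eta.
Proof.
rewrite /raise /mixed /lower exchange_big /=.
have -> : (#|I| - cnt I eta)%:R * h eta = \sum_(x in I | ~~ eta x) h eta.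
  rewrite sumr_const mulr_natl; congr (_ *+ _).
  have -> : cnt I eta = #|I :&: [set x | eta x]|.
    by apply: eq_card => z; rewrite !inE.
  by rewrite -cardsD; apply: eq_card => z; rewrite !inE andbC.
rewrite -big_split /=; apply: eq_bigr => x /andP[xI ex].
rewrite (bigD1 x) ?flip_at ?ex ?xI //= flipK; congr (_ + _).
rewrite [LHS]big_mkcond [RHS]big_mkcond /=; apply: eq_bigr => y _.
have [->|yx] := eqVneq y x; first by rewrite (negbTE ex) !andbF.
rewrite flip_away // andbT; case: ifP => // /andP[_ ey].
by rewrite flip_flip 1?xchgC // ey (negbTE ex).
Qed.

Definition nrm2 h : R := \sum_eta h eta ^+ 2.

Lemma nrm2_ge0 h : 0 <= nrm2 h.
Proof. by apply: sumr_ge0 => eta _; rewrite sqr_ge0. Qed.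

Lemma nrm2_lower I h : nrm2 (lower I h) = \sum_eta h eta * raise I (lower I h) eta.
Proof. by rewrite -lower_adj; apply: eq_bigr => eta _; rewrite expr2. Qed.

Lemma cauchy_schwarz_sum (J : finType) (u v : J -> R) :
  (\sum_i u i * v i) ^+ 2 <= (\sum_i u i ^+ 2) * (\sum_i v i ^+ 2).
Proof.
set A := \sum_i u i ^+ 2; set B := \sum_i v i ^+ 2; set C := \sum_i u i * v i.
have A0 : 0 <= A by apply: sumr_ge0 => i _; rewrite sqr_ge0.
have key : 0 <= A * (A * B - C ^+ 2).
  have -> : A * (A * B - C ^+ 2) = \sum_i (A * v i - C * u i) ^+ 2.
    transitivity (\sum_i (A ^+ 2 * v i ^+ 2 - 2 * A * C * (u i * v i) + C ^+ 2 * u i ^+ 2)).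
      by rewrite big_split sumrB /= -!mulr_sumr -/A -/B -/C; ring.
    by apply: eq_bigr => i _; ring.
  by apply: sumr_ge0 => i _; rewrite sqr_ge0.
have [A_0|An0] := eqVneq A 0; last first.
  by rewrite pmulr_rge0 ?lt_def ?An0 // subr_ge0 in key.
have u0 i : u i = 0.
  apply/eqP; rewrite -sqrf_eq0; apply/eqP.
  by apply: (psumr_eq0P _ A_0) => // j _; rewrite sqr_ge0.
by rewrite /C big1 ?expr0n ?A_0 ?mul0r // => i _; rewrite u0 mul0r.
Qed.

Definition in_slice I m h := forall eta, cnt I eta != m -> h eta = 0.

Lemma cnt_flip I x eta : x \in I -> cnt I (flip x eta) = if eta x then (cnt I eta).-1 else (cnt I eta).+1.
Proof.
move=> xI; rewrite /cnt; case: ifP => ex.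
  rewrite [in RHS](cardsD1 x) !inE xI ex add1n /=; apply: eq_card => y.
  rewrite !inE; have [->|yx] := eqVneq y x; first by rewrite flip_at ex !andbF.
  by rewrite flip_away.
rewrite (cardsD1 x) !inE xI flip_at ex add1n; congr _.+1; apply: eq_card => y.
rewrite !inE; have [->|yx] := eqVneq y x; first by rewrite ex !andbF.
by rewrite flip_away.
Qed.

Lemma lower_slice I m h : in_slice I m.+1 h -> in_slice I m (lower I h).
Proof.
move=> hs eta ne; rewrite /lower big1 // => x /andP[xI ex]; apply: hs.
by rewrite cnt_flip // (negbTE ex).
Qed.

(** In the summed [lower] a configuration is met once for each of its particles in [I], hence the
    weight [cnt]. On one slice this weight is constant, so centring is inherited by [lower I h]. *)
Lemma lower_outside I h : (forall zeta, \sum_(eta | outside_eq I eta zeta) (cnt I eta)%:R * h eta = 0) ->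
  forall zeta, \sum_(eta | outside_eq I eta zeta) lower I h eta = 0.
Proof.
move=> h0 zeta; rewrite -[RHS](h0 zeta) /lower.
under eq_bigr do rewrite big_mkcondr.
rewrite exchange_big /=.
transitivity (\sum_(x in I) \sum_(eta | outside_eq I eta zeta) if eta x then h eta else 0).
  apply: eq_bigr => x xI; rewrite (reindex_inj (inv_inj (@flipK x))) /=.
  apply: eq_big => [eta|eta _]; last by rewrite flipK flip_at negbK.
  apply: eq_forallb => z; case zI: (z \in I) => //=.
  by rewrite flip_away //; apply: contraFneq zI => ->.
rewrite exchange_big; apply: eq_bigr => eta _.
rewrite -big_mkcondr /= sumr_const mulr_natl; congr (_ *+ _).
by apply: eq_card => x; rewrite !inE.
Qed.

Lemma outside_eq_cnt0 I eta zeta : outside_eq I eta zeta -> cnt I eta = cnt I zeta -> cnt I zeta = 0%N -> eta = zeta.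
Proof.
move=> /forallP oe e1 e2; apply/ffunP => z.
have := oe z; case zI: (z \in I) => /=; last by move/eqP.
move=> _.
move: e1; rewrite e2 => /eqP; rewrite cards_eq0 => /eqP/setP/(_ z).
move: e2 => /eqP; rewrite cards_eq0 => /eqP/setP/(_ z).
by rewrite !inE zI /= => -> ->.
Qed.

Lemma outside_eq_refl I eta : outside_eq I eta eta.
Proof. by apply/forallP => z; apply/implyP. Qed.

(* raise lower - lower raise = 2m - |I| on slice m (an sl2 relation), so by
   Cauchy-Schwarz a bound for lower on slice m carries over to slice m + 1. *)
Lemma lower_bound I m h : in_slice I m h ->
  (forall zeta, \sum_(eta | outside_eq I eta zeta) h eta = 0) ->
  nrm2 (lower I h) <= (m%:R - 1) * (#|I|%:R - m%:R) * nrm2 h.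
Proof.
elim: m h => [|m IH] h hs h0.
  have hz eta : h eta = 0.
    have [c0|/hs//] := eqVneq (cnt I eta) 0%N.
    rewrite -[RHS](h0 eta) (bigD1 eta) ?outside_eq_refl //= big1 ?addr0 //.
    move=> z /andP[oe ne]; have [cz|/hs//] := eqVneq (cnt I z) 0%N.
    by move: ne; rewrite (outside_eq_cnt0 oe) ?eqxx // cz c0.
  rewrite /nrm2 !big1 ?mulr0 // => eta _; first by rewrite hz expr0n.
  by rewrite /lower big1 ?expr0n.
have [lt|ge] := ltnP #|I| m.+1.
  have hz eta : h eta = 0.
    apply: hs; apply: contraTneq lt => <-; rewrite -leqNgt.
    by apply: subset_leq_card; apply/fintype.subsetP => x; rewrite inE => /andP[].
  rewrite /nrm2 !big1 ?mulr0 // => eta _; first by rewrite hz expr0n.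
  by rewrite /lower big1 ?expr0n.
set g := lower I h.
have gs : in_slice I m g by apply: lower_slice.
have g0 zeta : \sum_(eta | outside_eq I eta zeta) g eta = 0.
  move: zeta; apply: lower_outside => zeta.
  transitivity (m.+1%:R * \sum_(eta | outside_eq I eta zeta) h eta); last by rewrite h0 mulr0.
  rewrite mulr_sumr; apply: eq_bigr => eta _.
  by have [->//|/hs->] := eqVneq (cnt I eta) m.+1; rewrite !mulr0.
have {IH}gb := IH g gs g0.
have rg : nrm2 (raise I g) = nrm2 (lower I g) + (#|I|%:R - 2 * m%:R) * nrm2 g.
  transitivity (\sum_eta g eta * lower I (raise I g) eta).
    rewrite /nrm2; under eq_bigr do rewrite expr2.
    by rewrite -lower_adj; apply: eq_bigr => eta _; rewrite mulrC.
  transitivity (\sum_eta g eta * raise I (lower I g) eta + (#|I|%:R - 2 * m%:R) * nrm2 g); last first.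
    by rewrite nrm2_lower.
  rewrite /nrm2 mulr_sumr -big_split; apply: eq_bigr => eta _ /=.
  rewrite raise_lower lower_raise.
  have [ce|/gs->] := eqVneq (cnt I eta) m; last by rewrite expr0n !mul0r mulr0 add0r.
  by rewrite ce natrB ?(ltnW ge) //; ring.
have cs : nrm2 g ^+ 2 <= nrm2 h * nrm2 (raise I g).
  have {1}-> : nrm2 g = \sum_eta h eta * raise I g eta.
    by rewrite -lower_adj; apply: eq_bigr => eta _; rewrite expr2.
  exact: cauchy_schwarz_sum.
have c0 : 0 <= (m.+1%:R - 1) * (#|I|%:R - m.+1%:R) :> R.
  by rewrite mulr_ge0 // subr_ge0 ?ler_nat // ler1n.
have [gz|gnz] := eqVneq (nrm2 g) 0; first by rewrite gz mulr_ge0 // nrm2_ge0.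
have gp : 0 < nrm2 g by rewrite lt_def gnz nrm2_ge0.
rewrite -(ler_pM2r gp) -expr2 (le_trans cs) //.
rewrite rg mulrAC mulrC ler_wpM2r ?nrm2_ge0 //.
rewrite (_ : (m.+1%:R - 1) * _ * _ = (m%:R - 1) * (#|I|%:R - m%:R) * nrm2 g + (#|I|%:R - 2 * m%:R) * nrm2 g).
  by rewrite lerD2r.
by rewrite -natr1; ring.
Qed.

Lemma cnt_le I eta : (cnt I eta <= #|I|)%N.
Proof. by apply: subset_leq_card; apply/fintype.subsetP => x; rewrite inE => /andP[]. Qed.

Lemma cnt_xchg I x y eta : x \in I -> y \in I -> cnt I (xchg x y eta) = cnt I eta.
Proof.
move=> xI yI; rewrite /cnt -(card_imset _ (@perm_inj _ (tperm x y))); apply: eq_card => z.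
rewrite -{1}(tpermK x y z) mem_imset; last exact: perm_inj.
rewrite !inE ffunE tpermK; congr (_ && _).
by case: tpermP => [->|->|//]; rewrite ?xI ?yI.
Qed.

Definition exchange_form I h : R :=
  \sum_(x in I) \sum_(y in I) \sum_eta (h eta - h (xchg x y eta)) ^+ 2.

(** One factor 2 comes from expanding the square under the exchange-invariant counting measure, the
    other from the two orders of a particle-hole pair; equal spins contribute nothing. *)
Lemma exchange_formE I h : exchange_form I h =
  4 * \sum_eta h eta * ((cnt I eta)%:R * (#|I| - cnt I eta)%:R * h eta - mixed I h eta).
Proof.
transitivity (2 * \sum_(x in I) \sum_(y in I) \sum_eta h eta * (h eta - h (xchg x y eta))).
  rewrite /exchange_form mulr_sumr; apply: eq_bigr => x xI.
  rewrite mulr_sumr; apply: eq_bigr => y yI.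
  transitivity (\sum_eta h eta * (h eta - h (xchg x y eta)) +
     \sum_eta h (xchg x y eta) * (h (xchg x y eta) - h (xchg x y (xchg x y eta)))).
    by rewrite -big_split; apply: eq_bigr => eta _; rewrite xchgK /=; ring.
  by rewrite (sum_xchg x y (fun eta => h eta * (h eta - h (xchg x y eta)))); ring.
rewrite (_ : (4 : R) = 2 * 2) -?mulrA; last by ring.
congr (2 * _).
under eq_bigr do rewrite exchange_big /=.
rewrite exchange_big mulr_sumr; apply: eq_bigr => eta _ /=.
under eq_bigr do rewrite -mulr_sumr.
rewrite -mulr_sumr mulrCA; congr (_ * _).
pose G x y := h eta - h (xchg x y eta).
have G0 x y : eta x = eta y -> G x y = 0 by move=> e; rewrite /G xchg_id ?subrr.
have GC x y : G x y = G y x by rewrite /G xchgC.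
have GE : \sum_(x in I | eta x) \sum_(y in I | ~~ eta y) G x y =
    (cnt I eta)%:R * (#|I| - cnt I eta)%:R * h eta - mixed I h eta.
  rewrite /mixed; pose q : R := (#|I| - cnt I eta)%:R * h eta.
  rewrite (eq_bigr (fun x => q - \sum_(y in I | ~~ eta y) h (xchg x y eta))); last first.
    move=> x _; rewrite sumrB; congr (_ - _); rewrite sumr_const /q mulr_natl; congr (_ *+ _).
    have -> : cnt I eta = #|I :&: [set x | eta x]|.
      by apply: eq_card => z; rewrite !inE.
    by rewrite -cardsD; apply: eq_card => z; rewrite !inE andbC.
  rewrite sumrB -mulrA -/q; congr (_ - _); rewrite sumr_const mulr_natl; congr (_ *+ _).
  by apply: eq_card => x; rewrite !inE.
rewrite -GE -/G.
transitivity (\sum_(x in I | eta x) \sum_(y in I | ~~ eta y) G x y +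
              \sum_(x in I | ~~ eta x) \sum_(y in I | eta y) G x y).
  rewrite (bigID eta) /=; congr (_ + _); apply: eq_bigr => x /andP[_ ex].
  - rewrite (bigID eta) /= [X in X + _]big1 ?add0r // => y /andP[_ ey].
    by apply: G0; rewrite ex ey.
  - rewrite (bigID eta) /= [X in _ + X]big1 ?addr0 // => y /andP[_ ey].
    by apply: G0; rewrite (negbTE ex) (negbTE ey).
rewrite [X in _ + X]exchange_big mulrDl mul1r; congr (_ + _).
by apply: eq_bigr => x _; apply: eq_bigr => y _; rewrite GC.
Qed.

(** On slice m, [mixed] is [raise lower] minus m, so [lower_bound] controls its quadratic form. What
    remains, m (|I| - m) - (m - 1) (|I| - m) + m = |I|, does not depend on m. *)
Lemma gap_slice I m h : in_slice I m h ->
  (forall zeta, \sum_(eta | outside_eq I eta zeta) h eta = 0) ->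
  4 * #|I|%:R * nrm2 h <= exchange_form I h.
Proof.
move=> hs h0; rewrite exchange_formE -mulrA ler_pM2l //.
have lb := lower_bound hs h0.
have le : \sum_eta h eta * mixed I h eta <= ((m%:R - 1) * (#|I|%:R - m%:R) - m%:R) * nrm2 h.
  rewrite mulrBl lerBrDr; apply: le_trans lb.
  rewrite nrm2_lower /nrm2 mulr_sumr -big_split /= ler_sum // => eta _.
  rewrite raise_lower.
  have [->|/hs->] := eqVneq (cnt I eta) m; last by rewrite !mul0r expr0n mulr0 addr0.
  by rewrite le_eqVlt; apply/orP; left; apply/eqP; ring.
have -> : \sum_eta h eta * ((cnt I eta)%:R * (#|I| - cnt I eta)%:R * h eta - mixed I h eta)
  = m%:R * (#|I|%:R - m%:R) * nrm2 h - \sum_eta h eta * mixed I h eta.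
  rewrite /nrm2 mulr_sumr -sumrB; apply: eq_bigr => eta _.
  have [ce|/hs->] := eqVneq (cnt I eta) m; last by rewrite !mul0r expr0n mulr0 subr0.
  by rewrite ce natrB -?{1}ce ?cnt_le //; ring.
by rewrite lerBrDl (le_trans (lerD le (lexx _))) // -mulrDl ler_wpM2r ?nrm2_ge0 //; lra.
Qed.

(** Exchanges inside [I] conserve its particle number, so both sides split over the slices, which
    all have the same gap. *)
Theorem bernoulli_laplace_gap I h : centred I h ->
  4 * #|I|%:R * nrm2 h <= exchange_form I h.
Proof.
move=> hc.
pose hm m eta := if cnt I eta == m then h eta else 0.
have slice (G : conf -> R) : \sum_eta G eta =
    \sum_(m < #|I|.+1) \sum_eta if cnt I eta == m then G eta else 0.
  rewrite exchange_big; apply: eq_bigr => eta _.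
  have lt : (cnt I eta < #|I|.+1)%N by rewrite ltnS cnt_le.
  rewrite (bigD1 (Ordinal lt)) //= eqxx big1 ?addr0 // => i.
  by rewrite -val_eqE eq_sym => /= /negbTE->.
have -> : exchange_form I h = \sum_(m < #|I|.+1) exchange_form I (hm m).
  rewrite /exchange_form [RHS]exchange_big; apply: eq_bigr => x xI.
  rewrite [RHS]exchange_big; apply: eq_bigr => y yI.
  rewrite slice; apply: eq_bigr => m _; apply: eq_bigr => eta _.
  by rewrite /hm cnt_xchg //; case: ifP; rewrite ?subrr ?expr0n.
have -> : nrm2 h = \sum_(m < #|I|.+1) nrm2 (hm m).
  rewrite /nrm2 slice; apply: eq_bigr => m _; apply: eq_bigr => eta _.
  by rewrite /hm; case: ifP; rewrite ?expr0n.
rewrite mulr_sumr ler_sum // => m _.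
apply: (@gap_slice _ m) => [eta /negbTE ne|zeta]; first by rewrite /hm ne.
by rewrite /hm -big_mkcondr hc.
Qed.

End BernoulliLaplace.

(** * Exchange classes, conditional means and centring inside an interval *)

Section ExchangeClasses.
Variables (R : realFieldType) (T : finType) (I : {set T}).
Notation conf := {ffun T -> bool}.
Implicit Types (eta zeta : conf) (f g h : conf -> R).

Definition same_class eta zeta : bool :=
  outside_eq I eta zeta && (cnt I eta == cnt I zeta).

Lemma same_class_refl eta : same_class eta eta.
Proof. by rewrite /same_class outside_eq_refl eqxx. Qed.

Lemma same_class_sym eta zeta : same_class eta zeta = same_class zeta eta.
Proof.
rewrite /same_class eq_sym; congr (_ && _); apply: eq_forallb => z.
by rewrite (eq_sym (eta z)).
Qed.

Lemma same_class_trans eta zeta xi :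
  same_class eta zeta -> same_class zeta xi -> same_class eta xi.
Proof.
move=> /andP[/forallP o1 /eqP e1] /andP[/forallP o2 /eqP e2].
rewrite /same_class e1 e2 eqxx andbT; apply/forallP => z.
have := o1 z; have := o2 z.
by case: (z \notin I) => //= /eqP <- /eqP <-.
Qed.

Lemma same_class_eqr eta zeta xi :
  same_class eta zeta -> same_class xi eta = same_class xi zeta.
Proof.
move=> ez; apply/idP/idP => h; first exact: same_class_trans h ez.
by apply: same_class_trans h _; rewrite same_class_sym.
Qed.

Lemma same_class_xchg x y eta : x \in I -> y \in I -> same_class (xchg x y eta) eta.
Proof.
move=> xI yI; rewrite /same_class cnt_xchg // eqxx andbT.
apply/forallP => z; apply/implyP => zI; rewrite ffunE.
by case: tpermP => [e|e|//]; rewrite e ?xI ?yI in zI.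
Qed.

Lemma centredP h :
  (forall zeta, \sum_(eta | same_class eta zeta) h eta = 0) <-> centred I h.
Proof.
split=> [h0 zeta m|hc zeta]; last by rewrite -[RHS](hc zeta (cnt I zeta)).
case: (pickP (fun eta => outside_eq I eta zeta && (cnt I eta == m))) => [xi /andP[/forallP o /eqP c]|e].
  rewrite -[RHS](h0 xi); apply: eq_bigl => eta; rewrite /same_class c; congr (_ && _).
  apply: eq_forallb => z; have := o z.
  by case: (z \notin I) => //= /eqP->.
by rewrite big_pred0.
Qed.

Lemma cnt_total eta : #|[set x | eta x]| = (cnt I eta + cnt (~: I) eta)%N.
Proof.
rewrite -(cardsID I); congr (_ + _)%N; apply: eq_card => x; rewrite !inE andbC //.
Qed.

Lemma outside_eq_cnt eta zeta : outside_eq I eta zeta -> cnt (~: I) eta = cnt (~: I) zeta.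
Proof.
move=> /forallP o; apply: eq_card => x; rewrite !inE; have := o x.
by case: (x \in I) => //= /eqP->.
Qed.

Lemma same_class_total eta zeta : same_class eta zeta ->
  #|[set x | eta x]| = #|[set x | zeta x]|.
Proof. by case/andP => o /eqP c; rewrite !cnt_total c (outside_eq_cnt o). Qed.

Definition class_card eta : R := (#|[set zeta | same_class zeta eta]|)%:R.

Lemma class_card_gt0 eta : 0 < class_card eta.
Proof.
by rewrite ltr0n card_gt0; apply/set0Pn; exists eta; rewrite inE same_class_refl.
Qed.

Lemma class_card_eq eta zeta : same_class eta zeta -> class_card eta = class_card zeta.
Proof.
move=> e; congr (_%:R); apply: eq_card => xi; rewrite !inE.
exact: same_class_eqr.
Qed.

(** Spreading each value of [g] evenly over its class turns the sum into one over classes, each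
    carrying the vanishing class sum of [f]. *)
Lemma centred_orthogonal f g : centred I f ->
  (forall eta zeta, same_class eta zeta -> g eta = g zeta) ->
  \sum_eta f eta * g eta = 0.
Proof.
move=> /centredP f0 gc.
transitivity (\sum_eta \sum_(zeta | same_class zeta eta) f eta * (g zeta / class_card zeta)).
  apply: eq_bigr => eta _; rewrite -mulr_sumr; congr (_ * _).
  rewrite (eq_bigr (fun=> g eta / class_card eta)); last first.
    by move=> zeta e; rewrite (gc _ _ e) (class_card_eq e).
  rewrite sumr_const -[LHS]mulr1 -(divff (lt0r_neq0 (class_card_gt0 eta))).
  rewrite mulrCA -[RHS]mulr_natl; congr (_ * _).
  by congr (_%:R); apply: eq_card => xi; rewrite !inE.
under eq_bigr do rewrite big_mkcond.
rewrite exchange_big big1 // => zeta _ /=.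
transitivity ((\sum_(eta | same_class eta zeta) f eta) * (g zeta / class_card zeta)).
  rewrite mulr_suml [RHS]big_mkcond.
  by apply: eq_bigr => eta _; rewrite same_class_sym.
by rewrite f0 mul0r.
Qed.

(** The conditional expectation given the spins outside [I] and the particle number in [I], under
    any weight that is constant on classes. *)
Definition class_mean f eta : R :=
  (\sum_(zeta | same_class zeta eta) f zeta) / class_card eta.

Lemma class_mean_eq f eta zeta : same_class eta zeta -> class_mean f eta = class_mean f zeta.
Proof.
move=> e; rewrite /class_mean (class_card_eq e); congr (_ / _).
by apply: eq_bigl => xi; apply: same_class_eqr.
Qed.

Lemma centred_sub_class_mean f g : (forall eta zeta, same_class eta zeta -> g eta = g zeta) ->
  centred I (fun eta => g eta * (f eta - class_mean f eta)).
Proof.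
move=> gc; apply/centredP => zeta.
rewrite (eq_bigr (fun eta => g zeta * (f eta - class_mean f zeta))); last first.
  by move=> eta e; rewrite (gc _ _ e) (class_mean_eq f e).
rewrite -mulr_sumr sumrB sumr_const -[X in _ - X]mulr_natl.
rewrite (_ : #|_|%:R = class_card zeta); last by congr (_%:R); apply: eq_card => xi; rewrite !inE.
by rewrite mulrCA divff ?mulr1 ?subrr ?mulr0 // lt0r_neq0 // class_card_gt0.
Qed.

Definition depends_on f : Prop :=
  forall eta zeta, (forall z, z \in I -> eta z = zeta z) -> f eta = f zeta.

Definition patch zeta eta : conf := [ffun z => if z \in I then eta z else zeta z].

(** Replacing the exterior spins by [patch] is a bijection of the two index sets that changes
    neither [f] nor the count in [I]. *)
Lemma outside_sum_indep f m zeta xi : depends_on f ->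
  \sum_(eta | outside_eq I eta zeta && (cnt I eta == m)) f eta =
  \sum_(eta | outside_eq I eta xi && (cnt I eta == m)) f eta.
Proof.
move=> fI; have patchP b c : outside_eq I b c = (patch c b == b).
  apply/forallP/eqP => [oe| <- z]; last by rewrite ffunE; case: (z \in I) => //=.
  by apply/ffunP => z; rewrite ffunE; have := oe z; case: ifP => //= _ /eqP->.
have patchK b c d : outside_eq I b c -> patch c (patch d b) = b.
  by rewrite patchP; move/eqP => e; apply/ffunP => z; rewrite -{2}e !ffunE; case: (z \in I).
rewrite (reindex_onto (patch zeta) (patch xi)) => [|eta /andP[oe _]]; last exact: patchK.
apply: eq_big => [eta|eta _]; last by apply: fI => z zI; rewrite ffunE zI.
rewrite (patchP eta) andbC; congr (_ && _).
  by congr (_ == _); apply/ffunP => z; rewrite !ffunE; case: (z \in I).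
have -> : cnt I (patch zeta eta) = cnt I eta.
  by apply: eq_card => z; rewrite !inE ffunE; case: (z \in I).
suff -> : outside_eq I (patch zeta eta) zeta by [].
by apply/forallP => z; rewrite ffunE; case: (z \in I) => /=.
Qed.

(* In the sum over configurations with m particles, the terms with a particle
   outside I vanish by induction on m. *)
Lemma centred_of_slice_sums f : depends_on f ->
  (forall k : nat, \sum_(eta : conf | #|[set x | eta x]| == k) f eta = 0) ->
  centred I f.
Proof.
move=> fI f0 zeta m; elim/ltn_ind: m zeta => m IH zeta.
(* Configurations are grouped by their exterior, padded with empty sites in [I]; the empty exterior
   [z0] is the one group left after the induction hypothesis. *)
pose out eta : conf := [ffun z => if z \in I then false else eta z].
pose z0 : conf := [ffun=> false].
have := f0 m; rewrite (partition_big out (fun xi => out xi == xi)) /=; last first.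
  by move=> eta _; apply/eqP/ffunP => z; rewrite !ffunE; case: (z \in I).
have outE eta xi : out xi = xi -> (out eta == xi) = outside_eq I eta xi.
  move=> e; apply/eqP/forallP => [<- z|oe].
    by rewrite ffunE; case: (z \in I) => //=.
  apply/ffunP => z; rewrite -e !ffunE; have := oe z.
  by case: (z \in I) => //= /eqP ->.
have cnt_out xi : out xi = xi -> #|[set x | xi x]| = cnt (~: I) xi.
  move=> e; apply: eq_card => z; rewrite !inE -e ffunE.
  by case: (z \in I).
have out0 : out z0 = z0 by apply/ffunP => z; rewrite !ffunE; case: (z \in I).
rewrite (bigD1 z0) ?out0 //= [X in _ + X]big1 ?addr0 => [|xi /andP[/eqP xo xn0]]; last first.
  have pos : (0 < cnt (~: I) xi)%N.
    rewrite -cnt_out // card_gt0; apply: contraNneq xn0 => e; apply/eqP/ffunP => z.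
    by have := finset.in_set0 z; rewrite -e inE ffunE.
  have [le|gt] := leqP (cnt (~: I) xi) m; last first.
    apply: big_pred0 => eta; rewrite outE //; apply/negP => /andP[/eqP c o].
    by move: gt; rewrite -c cnt_total (outside_eq_cnt o) ltnNge leq_addl.
  rewrite -[RHS](IH (m - cnt (~: I) xi)%N _ xi); last by rewrite ltn_subrL pos (leq_trans pos le).
  apply: eq_bigl => eta; rewrite outE // andbC; case o: (outside_eq I eta xi) => //=.
  by rewrite cnt_total (outside_eq_cnt o) -{1}(subnK le) eqn_add2r.
move=> e0; rewrite (outside_sum_indep _ _ z0 fI) -[RHS]e0; apply: eq_bigl => eta.
rewrite outE // andbC; case o: (outside_eq I eta z0); rewrite ?andbF //= andbT.
rewrite cnt_total (outside_eq_cnt o) (_ : cnt (~: I) z0 = 0)%N ?addn0 ?andbT //.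
by apply: eq_card0 => z; rewrite !inE ffunE andbF.
Qed.

End ExchangeClasses.

(** * The gap of nearest-neighbour exchanges in an interval *)

Section SpectralGap.
Variables (R : realType) (l : nat) (w : config l -> R).
Hypothesis w_ge0 : forall eta, 0 <= w eta.
Hypothesis w_count : forall eta zeta : config l,
  #|[set x | eta x]| = #|[set x | zeta x]| -> w eta = w zeta.
Implicit Types (u v f g phi psi : config l -> R) (x y z : 'I_l.+1) (I : {set 'I_l.+1}).

Definition avg phi : R := \sum_eta w eta * phi eta.

Lemma avg_ext phi psi : phi =1 psi -> avg phi = avg psi.
Proof. by move=> e; apply: eq_bigr => eta _; rewrite e. Qed.

Lemma avgD phi psi : avg (fun eta => phi eta + psi eta) = avg phi + avg psi.
Proof. by rewrite -big_split; apply: eq_bigr => eta _; rewrite mulrDr. Qed.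

Lemma avgZ c phi : avg (fun eta => c * phi eta) = c * avg phi.
Proof. by rewrite mulr_sumr; apply: eq_bigr => eta _; rewrite mulrCA. Qed.

Lemma avg_sum (J : Type) (s : seq J) (P : pred J) (phi : J -> config l -> R) :
  avg (fun eta => \sum_(i <- s | P i) phi i eta) = \sum_(i <- s | P i) avg (phi i).
Proof. by rewrite exchange_big; apply: eq_bigr => eta _; rewrite mulr_sumr. Qed.

Lemma avg_le phi psi : (forall eta, phi eta <= psi eta) -> avg phi <= avg psi.
Proof. by move=> h; apply: ler_sum => eta _; rewrite ler_wpM2l. Qed.

Lemma avg_ge0 phi : (forall eta, 0 <= phi eta) -> 0 <= avg phi.
Proof. by move=> h; apply: sumr_ge0 => eta _; rewrite mulr_ge0. Qed.

Lemma avg_cauchy_schwarz phi psi :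
  avg (fun eta => phi eta * psi eta) ^+ 2 <=
  avg (fun eta => phi eta ^+ 2) * avg (fun eta => psi eta ^+ 2).
Proof.
have E p q : avg (fun eta => p eta * q eta) =
    \sum_eta (Num.sqrt (w eta) * p eta) * (Num.sqrt (w eta) * q eta).
  by apply: eq_bigr => eta _; rewrite mulrACA -expr2 sqr_sqrtr.
have E2 p : avg (fun eta => p eta ^+ 2) = \sum_eta (Num.sqrt (w eta) * p eta) ^+ 2.
  by apply: eq_bigr => eta _; rewrite exprMn sqr_sqrtr.
by rewrite E !E2; apply: cauchy_schwarz_sum.
Qed.

Lemma w_xchg x y eta : w (xchg x y eta) = w eta.
Proof.
symmetry; apply: w_count; rewrite -(card_imset _ (@perm_inj _ (tperm x y))).
apply: eq_card => z; rewrite -{1}(tpermK x y z) mem_imset; last exact: perm_inj.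
by rewrite !inE ffunE.
Qed.

Lemma avg_xchg x y phi : avg (fun eta => phi (xchg x y eta)) = avg phi.
Proof.
rewrite [RHS]/avg -(sum_xchg x y); apply: eq_bigr => eta _.
by rewrite w_xchg.
Qed.

Definition bond_energy x y u : R := avg (fun eta => (u (xchg x y eta) - u eta) ^+ 2).

Lemma bond_energy_ge0 x y u : 0 <= bond_energy x y u.
Proof. by apply: avg_ge0 => eta; apply: sqr_ge0. Qed.

Lemma bond_energyC x y u : bond_energy x y u = bond_energy y x u.
Proof. by apply: avg_ext => eta; rewrite xchgC. Qed.

Lemma xchg_conj x y z eta : x != y -> x != z -> y != z ->
  xchg y z (xchg x y (xchg y z eta)) = xchg x z eta.
Proof.
move=> xy xz yz; apply/ffunP => s; rewrite !ffunE; congr (eta _).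
have yx : y != x by rewrite eq_sym.
have zx : z != x by rewrite eq_sym.
have zy : z != y by rewrite eq_sym.
have [<-|sx] := eqVneq x s; first by rewrite (tpermD yx zx) !tpermL.
have [<-|sy] := eqVneq y s.
  by rewrite tpermL (tpermD xz yz) tpermR (tpermD xy zy).
have [<-|sz] := eqVneq z s; first by rewrite !tpermR (tpermD yx zx).
by rewrite !tpermD.
Qed.

(* The transposition (x z) is (y z)(x y)(y z); the weight r makes the resulting
   bound along a path of length r linear in r. *)
Lemma bond_energy_step (r : nat) x y z u : (0 < r)%N -> x != y -> x != z -> y != z ->
  bond_energy x z u <=
  (1 + r%:R^-1) * bond_energy x y u + 4 * (1 + r%:R) * bond_energy y z u.
Proof.
move=> r0 xy xz yz; have rp : 0 < r%:R :> R by rewrite ltr0n.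
pose b eta := u (xchg x y (xchg y z eta)) - u (xchg y z eta).
pose a eta := u (xchg y z eta) - u eta.
pose c eta := u (xchg x z eta) - u (xchg x y (xchg y z eta)).
have Eb : avg (fun eta => b eta ^+ 2) = bond_energy x y u.
  by rewrite /bond_energy -[RHS](avg_xchg y z).
have Ec : avg (fun eta => c eta ^+ 2) = bond_energy y z u.
  rewrite -[LHS](avg_xchg y z) -[LHS](avg_xchg x y); apply: avg_ext => eta.
  by rewrite /c -(xchg_conj _ xy xz yz) !xchgK.
pose q eta := (1 + r%:R^-1) * b eta ^+ 2 + 2 * (1 + r%:R) * (a eta ^+ 2 + c eta ^+ 2).
apply: (@le_trans _ _ (avg q)).
  apply: avg_le => eta.
  rewrite (_ : u (xchg x z eta) - u eta = b eta + (a eta + c eta)); last by rewrite /a /b /c; ring.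
  have -> : q eta = (1 + r%:R^-1) * b eta ^+ 2 + (1 + r%:R) * (a eta + c eta) ^+ 2
     + (1 + r%:R) * (a eta - c eta) ^+ 2 by rewrite /q; ring.
  apply: (@le_trans _ _ ((1 + r%:R^-1) * b eta ^+ 2 + (1 + r%:R) * (a eta + c eta) ^+ 2)).
    rewrite -subr_ge0.
    rewrite (_ : _ - _ = r%:R^-1 * (b eta - r%:R * (a eta + c eta)) ^+ 2).
      by rewrite mulr_ge0 ?sqr_ge0 // invr_ge0 ltW.
    by field; rewrite lt0r_neq0.
  by rewrite lerDl mulr_ge0 ?sqr_ge0 // addr_ge0 // ltW.
rewrite /q avgD !avgZ avgD Eb Ec /a.
rewrite -/(bond_energy y z u); lra.
Qed.

(** The induction closes exactly: (1 + 1/r) times the factor 4 r is 4 (r + 1), which is also the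
    factor of the new bond. Injectivity supplies the three distinct sites that [bond_energy_step]
    needs. *)
Lemma path_energy (p : nat -> 'I_l.+1) (r : nat) u :
  {in [pred i | i <= r]%N &, injective p} ->
  bond_energy (p 0%N) (p r) u <=
  4 * r%:R * \sum_(s < r) bond_energy (p s) (p s.+1) u.
Proof.
elim: r => [|r IH] pinj.
  rewrite big_ord0 mulr0 le_eqVlt; apply/orP; left; apply/eqP.
  apply: big1 => eta _; rewrite (_ : xchg _ _ eta = eta) ?subrr ?expr0n ?mulr0 //.
  by rewrite xchg_id.
have ne i j : (i <= r.+1)%N -> (j <= r.+1)%N -> i != j -> p i != p j.
  by move=> ir jr; apply: contra_neq; apply: pinj.
have {}IH := IH (fun i j (ir : (i <= r)%N) (jr : (j <= r)%N) => pinj i j (leqW ir) (leqW jr)).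
rewrite big_ord_recr /=.
case: r => [|r] in pinj ne IH *.
  by rewrite big_ord0 add0r mulr1 ler_peMl ?bond_energy_ge0 // ler1n.
apply: le_trans (bond_energy_step (r := r.+1) (y := p r.+1) _ _ _ _ _) _ => //;
  try by apply: ne => //; lia.
have rp : 0 < r.+1%:R :> R by rewrite ltr0n.
have := ler_wpM2l (_ : 0 <= 1 + r.+1%:R^-1 :> R) IH.
move=> /(_ (addr_ge0 ler01 (ltW _))); rewrite invr_gt0 => /(_ rp) H.
apply: le_trans (lerD H (lexx _)) _.
rewrite -[r.+2%:R]natr1 le_eqVlt; apply/orP; left; apply/eqP.
by field; rewrite lt0r_neq0.
Qed.

Lemma val_step_muln (s : nat) : val (step l *+ s) = (s %% l.+1)%N.
Proof. by rewrite Zp_mulrn /= modnMml mul1n. Qed.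

Lemma energy_in_interval I x y u : is_subinterval I -> x \in I -> y \in I ->
  bond_energy x y u <= 4 * #|I|%:R * \sum_(z in I) bond_energy z (z + step l) u.
Proof.
case=> x0 [k ->] /imsetP[i _ ->] /imsetP[j _ ->].
wlog ij : i j / (i <= j)%N.
  move=> H; case: (leqP i j) => [|/ltnW] le; first exact: H.
  by rewrite bond_energyC; apply: H.
set I0 := [set _ | _ in _].
(* The interval may wrap around the torus, even several times; reducing modulo l + 1 yields an
   injective path with fewer than |I| bonds. *)
set r := ((j - i) %% l.+1)%N.
have rl : (r <= l)%N by rewrite -ltnS ltn_mod.
have rji : (r <= j - i)%N by apply: leq_mod.
pose p (s : nat) := x0 + step l *+ (i + s).
have pinj : {in [pred s | s <= r]%N &, injective p}.
  move=> s t; rewrite !inE => sr tr /addrI; rewrite !mulrnDr => /addrI/(congr1 val).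
  by rewrite !val_step_muln !modn_small //; lia.
have pI s : (s <= r)%N -> p s \in I0.
  move=> sr; have lt : (i + s < k.+1)%N by have := ltn_ord j; lia.
  by apply/imsetP; exists (Ordinal lt).
have -> : x0 + step l *+ i = p 0%N by rewrite /p addn0.
have -> : x0 + step l *+ j = p r.
  rewrite /p; congr (_ + _); apply: val_inj; rewrite !val_step_muln modnDmr.
  by rewrite subnKC.
have pin : injective (fun s : 'I_r.+1 => p s).
  by move=> s t /pinj e; apply: val_inj; apply: e; rewrite inE -ltnS.
have card : (r < #|I0|)%N.
  rewrite -[r.+1]card_ord -(card_imset _ pin); apply: subset_leq_card.
  by apply/fintype.subsetP => _ /imsetP[s _ ->]; apply: pI; rewrite -ltnS.
apply: le_trans (path_energy u pinj) _.
apply: ler_pM; rewrite ?mulr_ge0 ?ler0n //.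
- by apply: sumr_ge0 => s _; apply: bond_energy_ge0.
- by rewrite ler_wpM2l // ler_nat ltnW.
have pS s : p s.+1 = p s + step l by rewrite /p addnS mulrSr addrA.
pose wd := fun s : 'I_r => p s.
have wdi : injective wd.
  by move=> s t e; apply: val_inj; apply: pinj e; rewrite inE; have := ltn_ord s; have := ltn_ord t; lia.
rewrite (eq_bigr (fun s : 'I_r => bond_energy (wd s) (wd s + step l) u)); last first.
  by move=> s _; rewrite pS.
rewrite -(big_imset (fun z => bond_energy z (z + step l) u) (in2W wdi)) /=.
rewrite [leRHS](big_setID (wd @: 'I_r)) /= (finset.setIidPr _); last first.
  by apply/fintype.subsetP => _ /imsetP[s _ ->]; apply: pI; apply: ltnW.
by rewrite lerDl; apply: sumr_ge0 => z _; apply: bond_energy_ge0.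
Qed.

Lemma interval_gt0 I : is_subinterval I -> (0 < #|I|)%N.
Proof.
case=> x0 [k ->]; rewrite card_gt0; apply/set0Pn; exists (x0 + step l *+ 0%N).
by apply/imsetP; exists ord0.
Qed.

Lemma w_same_class I eta zeta : same_class I eta zeta -> w eta = w zeta.
Proof. by move=> /same_class_total/w_count. Qed.

(** Since [f] is orthogonal to functions constant on classes, [u] may be replaced by its deviation
    from the class mean, whose norm the spectral gap bounds by the energy. *)
Lemma interval_hminus1 I f u : is_subinterval I -> centred I f ->
  avg (fun eta => f eta * u eta) ^+ 2 <=
  avg (fun eta => f eta ^+ 2) * (#|I|%:R ^+ 2 * \sum_(z in I) bond_energy z (z + step l) u).
Proof.
move=> Iint fc; pose v eta := u eta - class_mean I u eta.
have a0 : 0 < #|I|%:R :> R by rewrite ltr0n interval_gt0.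
have -> : avg (fun eta => f eta * u eta) = avg (fun eta => f eta * v eta).
  rewrite [RHS](@avg_ext _ (fun eta => f eta * u eta + (-1) * (f eta * class_mean I u eta))); last first.
    by move=> eta; rewrite /v; ring.
  rewrite avgD avgZ (_ : avg (fun eta => f eta * class_mean I u eta) = 0) ?mulr0 ?addr0 //.
  rewrite -(centred_orthogonal fc (g := fun eta => w eta * class_mean I u eta)).
    by apply: eq_bigr => eta _; ring.
  by move=> eta zeta e; rewrite (w_same_class e) (class_mean_eq u e).
apply: le_trans (avg_cauchy_schwarz _ _) _; apply: ler_wpM2l; first by apply: avg_ge0 => eta; apply: sqr_ge0.
(* The square root turns the weighted norm into a plain sum of squares; it is constant on classes,
   so [h] remains centred. *)
pose h eta := Num.sqrt (w eta) * v eta.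
have hc : centred I h.
  by apply: centred_sub_class_mean => eta zeta e; rewrite (w_same_class e).
have -> : avg (fun eta => v eta ^+ 2) = nrm2 h.
  by apply: eq_bigr => eta _; rewrite exprMn sqr_sqrtr.
have := bernoulli_laplace_gap hc.
set E := \sum_(z in I) _ => gap.
rewrite -(ler_pM2l (_ : 0 < 4 * #|I|%:R)) ?mulr_gt0 //; apply: le_trans gap _.
(* The path comparison costs 4 |I| E for each of the |I|^2 pairs; the factor 4 |I| is exactly the
   one won from the gap. *)
have -> : 4 * #|I|%:R * (#|I|%:R ^+ 2 * E) = \sum_(x in I) \sum_(y in I) 4 * #|I|%:R * E.
  rewrite (eq_bigr (fun=> 4 * #|I|%:R * E *+ #|I|)) => [|x _]; last by rewrite sumr_const.
  by rewrite sumr_const -[RHS]mulr_natl -[X in _ = _ * X]mulr_natl expr2; move: E (#|I|%:R : R) => E a; ring.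
apply: ler_sum => x xI; apply: ler_sum => y yI.
apply: le_trans (energy_in_interval u Iint xI yI).
rewrite le_eqVlt; apply/orP; left; apply/eqP; apply: eq_bigr => eta _.
have e := same_class_xchg eta xI yI.
rewrite /h (w_same_class e) -mulrBr exprMn sqr_sqrtr // /v (class_mean_eq u e).
by congr (_ * _); ring.
Qed.

End SpectralGap.

(** * Averages over disjoint blocks: orthogonality and the H^{-1} bound *)

Section BlockAverages.
Variables (R : realType) (l : nat) (w : config l -> R).
Hypothesis w_ge0 : forall eta, 0 <= w eta.
Hypothesis w_count : forall eta zeta : config l,
  #|[set x | eta x]| = #|[set x | zeta x]| -> w eta = w zeta.
Hypothesis w_sum1 : \sum_eta w eta = 1.
Variables (n : nat) (f : 'I_n -> config l -> R) (I : 'I_n -> {set 'I_l.+1}) (K : R).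
Hypothesis n_gt0 : (0 < n)%N.
Hypothesis f_bound : forall i eta, `|f i eta| <= K.
Hypothesis I_interval : forall i, is_subinterval (I i).
Hypothesis I_disj : forall i j, i != j -> (I i :&: I j)%SET = finset.set0.
Hypothesis f_dep : forall i, depends_on (I i) (f i).
Hypothesis f_centred : forall i, centred (I i) (f i).

Definition block_avg (eta : config l) : R := n%:R^-1 * \sum_(i < n) f i eta.

Definition dirichlet (u : config l -> R) : R := \sum_x bond_energy w x (x + step l) u.

Definition max_size2 : R := (\max_(i < n) #|I i| ^ 2)%N%:R.

Lemma avg1 : avg w (fun=> 1) = 1.
Proof. by rewrite -[RHS]w_sum1; apply: eq_bigr => eta _; rewrite mulr1. Qed.

Lemma avg_const c : avg w (fun=> c) = c.
Proof. by rewrite -{2}[c]mulr1 -avg1 -avgZ; apply: avg_ext => eta; rewrite mulr1. Qed.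

Let K_ge0 : 0 <= K.
Proof. by apply: le_trans (f_bound (Ordinal n_gt0) [ffun=> false]). Qed.

Let n_pos : 0 < n%:R :> R. Proof. by rewrite ltr0n. Qed.

Lemma avg_f_sq i : avg w (fun eta => f i eta ^+ 2) <= K ^+ 2.
Proof.
rewrite -[leRHS]avg_const; apply: avg_le => // eta.
by rewrite -real_normK ?num_real // ler_pXn2r ?nnegrE.
Qed.

Lemma block_avg_bound eta : `|block_avg eta| <= K.
Proof.
rewrite /block_avg normrM ger0_norm ?invr_ge0 // mulrC ler_pdivrMr //.
apply: le_trans (ler_norm_sum _ _ _) _; apply: le_trans (ler_sum _ (fun i _ => f_bound i eta)) _.
by rewrite sumr_const card_ord mulr_natr.
Qed.

(** Products of different blocks average to zero: [f j] reads only spins outside [I i], so it is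
    constant on the exchange classes of [I i], where [f i] sums to zero. *)
Lemma block_avg_sq : avg w (fun eta => block_avg eta ^+ 2) <= K ^+ 2 / n%:R.
Proof.
have -> : avg w (fun eta => block_avg eta ^+ 2) =
    n%:R^-1 ^+ 2 * \sum_(i < n) avg w (fun eta => f i eta ^+ 2).
  rewrite -avg_sum -avgZ /block_avg.
  rewrite (@avg_ext _ _ _ _ (fun eta => n%:R^-1 ^+ 2 * (\sum_(i < n) \sum_(j < n) f i eta * f j eta))); last first.
    by move=> eta; rewrite exprMn; congr (_ * _); rewrite expr2 big_distrlr.
  rewrite !avgZ !avg_sum; congr (_ * _); apply: eq_bigr => i _.
  rewrite avg_sum (bigD1 i) //= big1 ?addr0 => [|j ji].
    by apply: avg_ext => eta; rewrite expr2.
  rewrite -[RHS](centred_orthogonal (@f_centred i) (g := fun eta => w eta * f j eta)).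
    by apply: eq_bigr => eta _; ring.
  move=> eta zeta e; rewrite (w_same_class w_count e); congr (_ * _).
  apply: f_dep => z zJ; case/andP: e => /forallP/(_ z); rewrite (_ : z \in I i = false) /=.
    by move/eqP.
  by apply/negP => zI; have := finset.in_setI z (I i) (I j); rewrite (I_disj _) 1?eq_sym // zI zJ finset.in_set0.
rewrite expr2 -mulrA; apply: (@le_trans _ _ (n%:R^-1 * (n%:R^-1 * (n%:R * K ^+ 2)))).
  rewrite !ler_wpM2l ?invr_ge0 ?(ltW n_pos) //.
  apply: le_trans (ler_sum _ (fun i _ => avg_f_sq i)) _.
  by rewrite sumr_const card_ord mulr_natl.
by rewrite mulKf ?lt0r_neq0 // mulrC.
Qed.

(** Cauchy-Schwarz over the blocks costs n against the prefactor n^-2, and disjointness lets the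
    local energies add up to at most one Dirichlet form. *)
Lemma block_avg_hminus1 u :
  avg w (fun eta => block_avg eta * u eta) ^+ 2 <= K ^+ 2 * max_size2 / n%:R * dirichlet u.
Proof.
pose a i := avg w (fun eta => f i eta * u eta).
have E0 z : 0 <= bond_energy w z (z + step l) u by apply: bond_energy_ge0.
have M0 : 0 <= max_size2 by rewrite ler0n.
have -> : avg w (fun eta => block_avg eta * u eta) = n%:R^-1 * \sum_i a i.
  rewrite -avg_sum -avgZ; apply: avg_ext => eta.
  by rewrite /block_avg -mulrA mulr_suml.
have cs : (\sum_i a i) ^+ 2 <= n%:R * \sum_i a i ^+ 2.
  have := cauchy_schwarz_sum (fun=> 1) a.
  under eq_bigr do rewrite mul1r; move/le_trans; apply.
  by rewrite sumr_const card_ord expr1n.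
have ai i : a i ^+ 2 <= K ^+ 2 * (max_size2 * \sum_(z in I i) bond_energy w z (z + step l) u).
  apply: le_trans (interval_hminus1 w_ge0 w_count u (I_interval i) (f_centred i)) _.
  apply: ler_pM.
  - by apply: avg_ge0 => // eta; apply: sqr_ge0.
  - by rewrite mulr_ge0 ?sqr_ge0 // sumr_ge0.
  - exact: avg_f_sq.
  - rewrite ler_wpM2r ?sumr_ge0 // -natrX ler_nat.
    exact: leq_bigmax.
have sumE : \sum_(i < n) \sum_(z in I i) bond_energy w z (z + step l) u <= dirichlet u.
  rewrite /dirichlet (eq_bigr (fun i => \sum_z if z \in I i then bond_energy w z (z + step l) u else 0));
    last by move=> i _; rewrite big_mkcond.
  rewrite exchange_big; apply: ler_sum => z _ /=; rewrite -big_mkcond /=.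
  case: (pickP (fun i => z \in I i)) => [i zi|no]; last by rewrite big_pred0.
  rewrite (bigD1 i) //= big_pred0 ?addr0 // => j.
  apply/negP => /andP[zj ji].
  by have := finset.in_setI z (I j) (I i); rewrite (I_disj ji) zi zj finset.in_set0.
rewrite exprMn; apply: (@le_trans _ _ (n%:R^-1 ^+ 2 * (n%:R * (K ^+ 2 * (max_size2 * dirichlet u))))).
  rewrite ler_wpM2l ?sqr_ge0 // (le_trans cs) // ler_wpM2l ?ler0n //.
  apply: le_trans (ler_sum _ (fun i _ => ai i)) _.
  by rewrite -!mulr_sumr !ler_wpM2l ?sqr_ge0.
rewrite le_eqVlt; apply/orP; left; apply/eqP.
by field; rewrite lt0r_neq0.
Qed.

End BlockAverages.

(** * Dissipation of the generator *)

Section GeneratorForms.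
Variables (R : realType) (l : nat) (w : config l -> R).
Hypothesis w_ge0 : forall eta, 0 <= w eta.
Hypothesis w_count : forall eta zeta : config l,
  #|[set x | eta x]| = #|[set x | zeta x]| -> w eta = w zeta.
Variables (N : nat) (d : (int -> bool) -> R) (B : R).
Hypothesis N_gt0 : (0 < N)%N.
Hypothesis d_bound : forall eta, `|d eta| <= B.
Notation L := (generator N d).
Notation nu := (N%:R : R).
Notation alpha := (nu `^ (3 / 2)).

Definition drift (x : 'I_l.+1) (eta : config l) : R :=
  (~~ eta x && eta (x + step l))%:R - (eta x && ~~ eta (x + step l))%:R.

Lemma driftE x eta : drift x eta = (eta (x + step l))%:R - (eta x)%:R.
Proof. by rewrite /drift; case: (eta x); case: (eta _) => /=; ring. Qed.

(** By [driftE] the drift is a discrete gradient and telescopes around the torus; this is why the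
    asymmetry without [d] preserves the canonical measure. *)
Lemma sum_drift eta : \sum_x drift x eta = 0.
Proof.
under eq_bigr do rewrite driftE.
rewrite sumrB [X in _ - X](reindex_inj (addIr (step l))) /=.
by rewrite subrr.
Qed.

Lemma drift_norm x eta : `|drift x eta| <= 1.
Proof.
rewrite /drift; case: (eta x); case: (eta _) => /=;
  by rewrite ?subrr ?subr0 ?sub0r ?normrN ?normr0 ?normr1.
Qed.

Lemma drift_swap x eta : drift x (swap_spins x eta) = - drift x eta.
Proof. by rewrite !driftE !ffunE tpermL tpermR opprB. Qed.

Lemma swap_spinsK x (eta : config l) : swap_spins x (swap_spins x eta) = eta.
Proof. exact: (xchgK x (x + step l)). Qed.

Lemma avg_antisym x (phi : config l -> R) :
  (forall eta, phi (swap_spins x eta) = - phi eta) -> avg w phi = 0.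
Proof.
move=> anti; have := avg_xchg w_count x (x + step l) phi.
rewrite (@avg_ext _ _ _ _ (fun eta => (-1) * phi eta)); last first.
  by move=> eta; rewrite mulN1r; exact: anti.
by rewrite avgZ; lra.
Qed.

Definition bias x (eta : config l) : R := drift x eta * d (shift_config x eta).

Lemma bias_norm x eta : `|bias x eta| <= B.
Proof.
by rewrite normrM -[B]mul1r ler_pM ?drift_norm ?d_bound.
Qed.

(** The [d]-part thus has rate N, the square root of the symmetric rate N^2, so Young's inequality
    absorbs it with an error free of N. *)
Lemma alphaM : alpha * nu `^ (- (1 / 2)) = nu.
Proof.
rewrite -powRD; last by apply/implyP => _; rewrite pnatr_eq0 -lt0n.
by rewrite (_ : 3 / 2 + - (1 / 2) = 1) ?powRr1 ?ler0n //; lra.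
Qed.

Lemma alpha_le : 0 <= alpha <= nu ^+ 2.
Proof.
rewrite powR_ge0 /= -powR_mulrn ?ler0n //.
by apply: ler_powR; rewrite ?ler1n //; lra.
Qed.

Lemma generatorE F eta : L F eta = \sum_x
  (2^-1 * nu ^+ 2 + 2^-1 * alpha * drift x eta + 2^-1 * nu * bias x eta) *
  (F (swap_spins x eta) - F eta).
Proof.
rewrite /generator !mulr_sumr -big_split; apply: eq_bigr => x _ /=.
rewrite (_ : 2^-1 * nu * bias x eta = 2^-1 * (alpha * nu `^ (- (1 / 2))) * bias x eta).
  by rewrite /bond_gen /bias /drift; ring.
by rewrite alphaM.
Qed.

(* Here a = u(eta), b = u(eta^{x,x+1}), c is the drift and k the d-part of the
   asymmetry.  The third term is odd under the swap, hence averages to 0, and the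
   last one sums to 0 over x because the drift does. *)
Lemma square_form_pointwise (a b c k nu' al : R) : `|k| <= B ->
  a * ((2^-1 * nu' ^+ 2 + 2^-1 * al * c + 2^-1 * nu' * k) * (b - a)) <=
  - (8^-1 * nu' ^+ 2) * (b - a) ^+ 2 + 2^-1 * B ^+ 2 * a ^+ 2
  + (4^-1 * nu' ^+ 2 * (b ^+ 2 - a ^+ 2) + 2^-1 * al * (c * (a * b)))
  - 2^-1 * al * a ^+ 2 * c.
Proof.
move=> kB; have k2 : k ^+ 2 <= B ^+ 2.
  by rewrite -real_normK ?num_real // ler_pXn2r ?nnegrE // (le_trans _ kB).
have h : k ^+ 2 * a ^+ 2 <= B ^+ 2 * a ^+ 2 by rewrite ler_wpM2r ?sqr_ge0.
have := sqr_ge0 (nu' * (b - a) - 2 * k * a); nra.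
Qed.

(** The symmetric part dissipates with coefficient 1/4. Half of it pays for the [d]-part; the
    remaining 1/8 serves the energy estimate of the potential. *)
Lemma square_form u : avg w (fun eta => u eta * L u eta) <=
  - (8^-1 * nu ^+ 2) * dirichlet w u + 2^-1 * B ^+ 2 * l.+1%:R * avg w (fun eta => u eta ^+ 2).
Proof.
pose A x eta := 4^-1 * nu ^+ 2 * (u (swap_spins x eta) ^+ 2 - u eta ^+ 2) +
   2^-1 * alpha * (drift x eta * (u eta * u (swap_spins x eta))).
pose D x eta := (u (swap_spins x eta) - u eta) ^+ 2.
have A0 x : avg w (fun eta => A x eta) = 0.
  by apply: (@avg_antisym x) => eta; rewrite /A swap_spinsK drift_swap; ring.
apply: (@le_trans _ _ (avg w (fun eta => \sum_x (- (8^-1 * nu ^+ 2) * D x eta +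
    2^-1 * B ^+ 2 * u eta ^+ 2 + A x eta)))).
  apply: avg_le => // eta /=; rewrite generatorE mulr_sumr.
  rewrite -[leRHS]subr0 -[X in _ <= _ - X](mulr0 (2^-1 * alpha * u eta ^+ 2)).
  rewrite -[X in _ <= _ - _ * X](sum_drift eta) mulr_sumr -sumrB.
  apply: ler_sum => x _; exact: square_form_pointwise (bias_norm x eta).
rewrite avg_sum (eq_bigr (fun x => - (8^-1 * nu ^+ 2) * bond_energy w x (x + step l) u
   + 2^-1 * B ^+ 2 * avg w (fun eta => u eta ^+ 2))); last first.
  by move=> x _; rewrite 2!avgD A0 addr0 !avgZ.
rewrite big_split /= -mulr_sumr sumr_const card_ord -/(dirichlet w u) -[X in _ + X <= _]mulr_natr.
by rewrite mulrAC.
Qed.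

(* As in [square_form_pointwise]: the long bracket is odd under the swap and the
   last term sums to 0 over x.  The asymmetric part tests against r^3 to
   -(al/8) c (b^2 - a^2) (b - a)^2, which the symmetric part dominates since
   al <= nu'^2. *)
Lemma cube_form_pointwise (a b c k nu' al : R) : `|k| <= B -> `|c| <= 1 ->
  0 <= al <= nu' ^+ 2 ->
  (1 + a) * ((2^-1 * nu' ^+ 2 + 2^-1 * al * c + 2^-1 * nu' * k) * (b ^+ 3 - a ^+ 3)) <=
  9 * B ^+ 2 * (a ^+ 2 + a ^+ 4)
  + (2^-1 * nu' ^+ 2 * (b ^+ 3 - a ^+ 3) + 4^-1 * nu' ^+ 2 * ((a + b) * (b ^+ 3 - a ^+ 3))
     + 2^-1 * al * (c * (a ^+ 3 + b ^+ 3) + 2^-1 * (c * (a * b ^+ 3 + a ^+ 3 * b))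
         + 4^-1 * (c * (a ^+ 4 + b ^+ 4)))
     + 9 / 2 * B ^+ 2 * (b ^+ 2 - a ^+ 2 + 2^-1 * (b ^+ 4 - a ^+ 4)))
  - al * (a ^+ 3 + 3 / 4 * a ^+ 4) * c.
Proof.
move=> kB c1 /andP[al0 al1].
have k2 : k ^+ 2 <= B ^+ 2.
  by rewrite -real_normK ?num_real // ler_pXn2r ?nnegrE // (le_trans _ kB).
pose X2 := (b - a) ^+ 2; pose t := a ^+ 2 + b ^+ 2; pose s := a ^+ 2 + a * b + b ^+ 2.
have X20 : 0 <= X2 by apply: sqr_ge0.
have t0 : 0 <= t by rewrite addr_ge0 ?sqr_ge0.
have s0 : 0 <= s by rewrite /s; nra.
have st : s <= 3 / 2 * t by rewrite /s /t; have := sqr_ge0 (a - b); nra.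
have nu0 : 0 <= nu' ^+ 2 by apply: sqr_ge0.
have diss : - (4^-1 * nu' ^+ 2) * (X2 * s) - 8^-1 * al * (c * (b ^+ 2 - a ^+ 2) * X2) <=
    - (16^-1 * nu' ^+ 2) * (X2 * t).
  have cb : - (al * (c * (b ^+ 2 - a ^+ 2))) <= nu' ^+ 2 * `|b ^+ 2 - a ^+ 2|.
    apply: le_trans (ler_norm _) _; rewrite normrN !normrM (ger0_norm al0).
    rewrite ler_pM ?mulr_ge0 //.
    by rewrite -[leRHS]mul1r ler_wpM2r.
  have cb2 := ler_wpM2l X20 cb.
  have key : `|b ^+ 2 - a ^+ 2| <= 2 * s - t / 2.
    rewrite ler_norml /s /t; apply/andP; split.
      by have := sqr_ge0 (a + 2 * b); have := sqr_ge0 b; nra.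
    by have := sqr_ge0 (b + 2 * a); have := sqr_ge0 a; nra.
  have key2 := ler_wpM2l (mulr_ge0 X20 nu0) key.
  nra.
have pert : 2^-1 * nu' * k * ((1 + a) * (b - a) * s) <=
    16^-1 * nu' ^+ 2 * (X2 * t) + 9 / 4 * B ^+ 2 * ((1 + a) ^+ 2 * t).
  pose Y := 24^-1 * nu' ^+ 2 * X2 + 3 / 2 * k ^+ 2 * (1 + a) ^+ 2.
  have Y0 : 0 <= Y.
    by rewrite /Y; have := mulr_ge0 nu0 X20; have := mulr_ge0 (sqr_ge0 k) (sqr_ge0 (1 + a)); lra.
  have YB : Y <= 24^-1 * nu' ^+ 2 * X2 + 3 / 2 * B ^+ 2 * (1 + a) ^+ 2.
    by rewrite lerD2l ler_wpM2r ?sqr_ge0 // ler_wpM2l.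
  have young : 2^-1 * nu' * k * ((1 + a) * (b - a)) <= Y.
    have := sqr_ge0 (nu' * (b - a) - 6 * k * (1 + a)); rewrite /Y /X2; nra.
  apply: (@le_trans _ _ (Y * s)); first by rewrite mulrA ler_wpM2r.
  apply: le_trans (ler_wpM2l Y0 st) _.
  have := ler_wpM2r t0 YB; nra.
have low : (1 + a) ^+ 2 * t <= 2 * (a ^+ 2 + b ^+ 2 + 3 / 2 * a ^+ 4 + 2^-1 * b ^+ 4).
  have h1 : (1 + a) ^+ 2 <= 2 + 2 * a ^+ 2 by have := sqr_ge0 (1 - a); nra.
  have := ler_wpM2r t0 h1; rewrite /t.
  have := sqr_ge0 (a ^+ 2 - b ^+ 2).
  nra.
have low2 := ler_wpM2l (sqr_ge0 B) low.
rewrite -subr_ge0; apply: le_trans (_ : 0 <= (- (16^-1 * nu' ^+ 2) * (X2 * t) -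
  (- (4^-1 * nu' ^+ 2) * (X2 * s) - 8^-1 * al * (c * (b ^+ 2 - a ^+ 2) * X2))) +
  (16^-1 * nu' ^+ 2 * (X2 * t) + 9 / 4 * B ^+ 2 * ((1 + a) ^+ 2 * t) -
   2^-1 * nu' * k * ((1 + a) * (b - a) * s)) +
  9 / 4 * (B ^+ 2 * (2 * (a ^+ 2 + b ^+ 2 + 3 / 2 * a ^+ 4 + 2^-1 * b ^+ 4)) -
   B ^+ 2 * ((1 + a) ^+ 2 * t))) _.
  by apply: addr_ge0; [apply: addr_ge0|rewrite mulr_ge0]; rewrite ?subr_ge0.
rewrite le_eqVlt; apply/orP; left; apply/eqP; rewrite /X2 /t /s; by field.
Qed.

(** For a law of density 1 + r the forward equation makes four times the left side the time
    derivative of the average of r^4. The r^2 on the right stems from the constant 1, that is, from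
    the [d]-part failing to preserve the measure. *)
Lemma cube_form r : avg w (fun eta => (1 + r eta) * L (fun z => r z ^+ 3) eta) <=
  9 * B ^+ 2 * l.+1%:R * (avg w (fun eta => r eta ^+ 2) + avg w (fun eta => r eta ^+ 4)).
Proof.
pose A x eta := let a := r eta in let b := r (swap_spins x eta) in let c := drift x eta in
  (2^-1 * nu ^+ 2 * (b ^+ 3 - a ^+ 3) + 4^-1 * nu ^+ 2 * ((a + b) * (b ^+ 3 - a ^+ 3))
     + 2^-1 * alpha * (c * (a ^+ 3 + b ^+ 3) + 2^-1 * (c * (a * b ^+ 3 + a ^+ 3 * b))
         + 4^-1 * (c * (a ^+ 4 + b ^+ 4)))
     + 9 / 2 * B ^+ 2 * (b ^+ 2 - a ^+ 2 + 2^-1 * (b ^+ 4 - a ^+ 4))).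
have A0 x : avg w (fun eta => A x eta) = 0.
  by apply: (@avg_antisym x) => eta; rewrite /A swap_spinsK drift_swap; ring.
apply: (@le_trans _ _ (avg w (fun eta => \sum_x (9 * B ^+ 2 * (r eta ^+ 2 + r eta ^+ 4) + A x eta)))).
  apply: avg_le => // eta /=; rewrite generatorE mulr_sumr.
  rewrite -[leRHS]subr0 -[X in _ <= _ - X](mulr0 (alpha * (r eta ^+ 3 + 3 / 4 * r eta ^+ 4))).
  rewrite -[X in _ <= _ - _ * X](sum_drift eta) mulr_sumr -sumrB.
  apply: ler_sum => x _.
  exact: cube_form_pointwise (bias_norm x eta) (drift_norm x eta) alpha_le.
rewrite avg_sum (eq_bigr (fun x => 9 * B ^+ 2 * (avg w (fun eta => r eta ^+ 2) + avg w (fun eta => r eta ^+ 4)))); last first.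
  by move=> x _; rewrite avgD A0 addr0 avgZ avgD.
by rewrite sumr_const card_ord -[X in X <= _]mulr_natr mulrAC.
Qed.

End GeneratorForms.

(** * Discretised evolution *)

Section FiniteChain.
Local Open Scope classical_set_scope.
Local Open Scope ring_scope.
Variables (R : realType) (S : finType) (p : R -> S -> S -> R) (L : (S -> R) -> S -> R).
Hypothesis p_trans : transition_function p.
Hypothesis p_gen : has_generator p L.
Hypothesis L_lin : forall F a, L F a = \sum_b F b * L (fun c => (c == b)%:R) a.
Implicit Types (u v F : S -> R) (a b c : S) (s t h K : R).

Definition evolve t u a : R := \sum_b p t a b * u b.

Lemma evolve0 u a : evolve 0 u a = u a.
Proof.
rewrite /evolve (bigD1 a) //= (tf_0 p_trans) eqxx mul1r big1 ?addr0 // => b ba.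
by rewrite (tf_0 p_trans) eq_sym (negbTE ba) mul0r.
Qed.

Lemma evolveD s t u a : 0 <= s -> 0 <= t -> evolve (s + t) u a = evolve s (evolve t u) a.
Proof.
move=> s0 t0; rewrite /evolve.
under eq_bigr do rewrite (tf_chapman_kolmogorov p_trans) // mulr_suml.
rewrite exchange_big; apply: eq_bigr => b _; rewrite mulr_sumr.
by apply: eq_bigr => c _; rewrite mulrA.
Qed.

Lemma evolve_norm t u K a : 0 <= t -> (forall b, `|u b| <= K) -> `|evolve t u a| <= K.
Proof.
move=> t0 uK; apply: le_trans (ler_norm_sum _ _ _) _.
rewrite -[leRHS]mul1r -(tf_sum1 p_trans a t0) mulr_suml.
apply: ler_sum => b _; rewrite normrM ger0_norm ?(tf_ge0 p_trans) //.
by rewrite ler_wpM2l ?(tf_ge0 p_trans).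
Qed.

Lemma evolve_lin t (k : R) u v a :
  evolve t (fun z => k * u z + v z) a = k * evolve t u a + evolve t v a.
Proof. by rewrite /evolve mulr_sumr -big_split; apply: eq_bigr => b _ /=; ring. Qed.

Lemma evolve_sum t (J : Type) (r : seq J) (P : pred J) (u : J -> S -> R) a :
  evolve t (fun z => \sum_(j <- r | P j) u j z) a = \sum_(j <- r | P j) evolve t (u j) a.
Proof.
by rewrite /evolve exchange_big; apply: eq_bigr => b _; rewrite mulr_sumr.
Qed.

Definition gen_norm : R := \sum_a \sum_b `|L (fun c => (c == b)%:R) a|.

Lemma gen_norm_ge0 : 0 <= gen_norm.
Proof. by apply: sumr_ge0 => a _; apply: sumr_ge0. Qed.

Lemma gen_bound u K a : (forall b, `|u b| <= K) -> `|L u a| <= gen_norm * K.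
Proof.
move=> uK; rewrite L_lin; apply: le_trans (ler_norm_sum _ _ _) _.
apply: (@le_trans _ _ (\sum_b `|L (fun c => (c == b)%:R) a| * K)).
  by apply: ler_sum => b _; rewrite normrM mulrC ler_wpM2l.
rewrite -mulr_suml; apply: ler_wpM2r; first exact: le_trans (normr_ge0 _) (uK a).
rewrite /gen_norm [leRHS](bigD1 a) //= lerDl.
by apply: sumr_ge0 => b _; apply: sumr_ge0.
Qed.

(* The generator condition is applied to the finitely many indicator functions only. *)
Lemma evolve_expansion (eps : R) : 0 < eps -> exists2 h0 : R, 0 < h0 &
  forall h, 0 < h -> h < h0 -> forall u K a, (forall b, `|u b| <= K) ->
  `|evolve h u a - u a - h * L u a| <= eps * h * K.
Proof.
move=> eps0; pose e1 := eps / (#|S|%:R + 1).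
have S1 : 0 < #|S|%:R + 1 :> R by rewrite ltr_wpDl ?ler0n.
have e10 : 0 < e1 by rewrite divr_gt0.
pose ind b : S -> R := fun c => (c == b)%:R.
have ev_ind t a b : evolve t (ind b) a = p t a b.
  rewrite /evolve (bigD1 b) //= /ind eqxx mulr1 big1 ?addr0 // => c cb.
  by rewrite (negbTE cb) mulr0.
have : \forall h \near (0 : R)^'+, forall ab : S * S,
    `|L (ind ab.2) ab.1 - h^-1 * (evolve h (ind ab.2) ab.1 - ind ab.2 ab.1)| <= e1.
  apply: filter_forall => -[a b] /=.
  have /cvgrPdist_le/(_ _ e10) := @p_gen (ind b) a.
  by [].
rewrite near_withinE => -[h0 /= h00 near0].
exists h0 => // h hp hh0 u K a uK.
have {}near0 b : `|L (ind b) a - h^-1 * (evolve h (ind b) a - ind b a)| <= e1.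
  apply: (near0 h _ hp (a, b)) => /=.
  by rewrite sub0r normrN gtr0_norm.
have step b : `|p h a b - ind b a - h * L (ind b) a| <= e1 * h.
  rewrite -ev_ind (_ : _ - _ = - (h * (L (ind b) a - h^-1 * (evolve h (ind b) a - ind b a)))).
    by rewrite normrN normrM gtr0_norm // mulrC ler_wpM2r ?(ltW hp).
  by field; rewrite lt0r_neq0.
have K0 : 0 <= K := le_trans (normr_ge0 _) (uK a).
have -> : evolve h u a - u a - h * L u a = \sum_b (p h a b - ind b a - h * L (ind b) a) * u b.
  rewrite L_lin /evolve mulr_sumr.
  have -> : u a = \sum_b ind b a * u b.
    rewrite (bigD1 a) //= /ind eqxx mul1r big1 ?addr0 // => b ba.
    by rewrite eq_sym (negbTE ba) mul0r.
  by rewrite -!sumrB; apply: eq_bigr => b _; rewrite /ind; ring.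
apply: le_trans (ler_norm_sum _ _ _) _.
apply: (@le_trans _ _ (\sum_(b : S) e1 * h * K)).
  by apply: ler_sum => b _; rewrite normrM ler_pM.
rewrite sumr_const -mulr_natr mulrAC ler_wpM2r // mulrAC ler_wpM2r ?(ltW hp) //.
by rewrite /e1 mulrAC ler_pdivrMr // ler_wpM2l ?(ltW eps0) // lerDl.
Qed.

(** On a fine grid each step moves [u] by o(h), and the errors merely add up because [evolve]
    contracts the sup norm. *)
Lemma evolve_invariant u t a : 0 <= t -> (forall b, L u b = 0) -> evolve t u a = u a.
Proof.
rewrite le_eqVlt => /predU1P[<- _|t0 Lu]; first exact: evolve0.
pose K := \sum_b `|u b|.
have uK b : `|u b| <= K by rewrite /K (bigD1 b) //= lerDl sumr_ge0.
have K0 : 0 <= K by apply: sumr_ge0.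
apply/eqP; rewrite -subr_eq0 -normr_le0; apply/ler_addgt0Pr => eps eps0; rewrite add0r.
(* Over M + 1 steps of length t / (M + 1) the total error becomes eps K / (K + 1). *)
have [|h0 h00 H] := @evolve_expansion (eps / (t * (K + 1))).
  by rewrite divr_gt0 // mulr_gt0 // ltr_wpDl.
have [M Mt] : exists M : nat, t / h0 < M.+1%:R.
  exists (Num.truncn (t / h0)); apply: truncnS_gt.
pose h := t / M.+1%:R.
have hp : 0 < h by rewrite divr_gt0.
have hh0 : h < h0 by rewrite ltr_pdivrMr // mulrC -ltr_pdivrMr.
have stepE j b : `|evolve (h *+ j) u b - u b| <= j%:R * (eps / (t * (K + 1)) * h * K).
  elim: j b => [|j IH] b; first by rewrite mulr0n evolve0 subrr normr0 mul0r.
  rewrite mulrSr evolveD ?mulrn_wge0 ?(ltW hp) //.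
  rewrite (_ : _ - u b = evolve (h *+ j) (fun z => (-1) * u z + evolve h u z) b + (evolve (h *+ j) u b - u b)); last first.
    by rewrite evolve_lin; ring.
  rewrite -natr1 mulrDl mul1r [leRHS]addrC.
  apply: le_trans (ler_normD _ _) _; rewrite lerD //.
  apply: evolve_norm; first by rewrite mulrn_wge0 ?(ltW hp).
  move=> c; rewrite mulN1r addrC; have := H h hp hh0 u K c uK.
  by rewrite Lu mulr0 subr0.
have := stepE M.+1 a; rewrite -[h *+ _]mulr_natr divfK ?pnatr_eq0 //.
move/le_trans; apply.
have -> : M.+1%:R * (eps / (t * (K + 1)) * h * K) = eps * (K / (K + 1)).
  have m0 : M.+1%:R != 0 :> R by rewrite pnatr_eq0.
  have K1 : K + 1 != 0 by rewrite lt0r_neq0 // ltr_wpDl.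
  rewrite /h; move: (M.+1%:R : R) m0 => m m0; field.
  by rewrite m0 K1 (lt0r_neq0 t0).
by rewrite -[leRHS]mulr1 ler_wpM2l ?(ltW eps0) // ler_pdivrMr ?ltr_wpDl // mul1r lerDl.
Qed.

End FiniteChain.

(** With no initial value the bound is proportional to the accumulated source [m * c]; this is where
    powers of the time horizon are gained. *)
Lemma discrete_gronwall (R : realType) (a : nat -> R) (q c : R) (M : nat) :
  0 <= q -> 0 <= c -> a 0%N <= 0 ->
  (forall m, (m < M)%N -> a m.+1 <= (1 + q) * a m + c) ->
  forall m, (m <= M)%N -> a m <= m%:R * c * expR (q * m%:R).
Proof.
move=> q0 c0 a0 step; elim=> [|m IH] mM; first by rewrite !mul0r.
have q1 : 1 + q <= expR q by apply: expR_ge1Dx.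
apply: le_trans (step _ mM) _.
apply: (@le_trans _ _ ((1 + q) * (m%:R * c * expR (q * m%:R)) + c)).
  by rewrite lerD2r ler_wpM2l ?addr_ge0 // IH // ltnW.
rewrite -[in leRHS]natr1 mulrDr mulr1 expRD.
have e1 : 1 <= expR (q * m%:R) * expR q.
  by rewrite -expRD -expR0 ler_expR addr_ge0 // mulr_ge0.
have mc : 0 <= m%:R * c * expR (q * m%:R) by rewrite !mulr_ge0 // expR_ge0.
have h1 := ler_wpM2r mc q1; have h2 := ler_wpM2l c0 e1.
move: h1 h2; set e := expR q; set E := expR (q * m%:R); set n := m%:R => h1 h2.
have -> : (n + 1) * c * (E * e) = e * (n * c * E) + c * (E * e) by ring.
by rewrite lerD //; move: h2; rewrite mulr1.
Qed.

(** * Energy of the discretised time integral of the semigroup *)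

Section DiscreteEnergy.
Variables (R : realType) (l : nat) (w : config l -> R).
Hypothesis w_ge0 : forall eta, 0 <= w eta.
Hypothesis w_count : forall eta zeta : config l,
  #|[set x | eta x]| = #|[set x | zeta x]| -> w eta = w zeta.
Hypothesis w_sum1 : \sum_eta w eta = 1.
Variables (N : nat) (d : (int -> bool) -> R) (B : R).
Hypothesis N_gt0 : (0 < N)%N.
Hypothesis d_bound : forall eta, `|d eta| <= B.
Notation L := (@generator R N l d).
Notation nu := (N%:R : R).
Notation e := (l.+1%:R : R).
Variable p : R -> config l -> config l -> R.
Hypothesis p_trans : transition_function p.
Hypothesis p_gen : has_generator p L.
Variables (F : config l -> R) (K sigma2 : R).
Hypothesis F_bound : forall eta, `|F eta| <= K.
Hypothesis sigma2_gt0 : 0 < sigma2.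
Hypothesis F_hminus1 : forall u,
  avg w (fun eta => F eta * u eta) ^+ 2 <= nu ^+ 2 * sigma2 * dirichlet w u.
Variables (T K1 : R).
Hypothesis T_gt0 : 0 < T.
Hypothesis eT_le : e * T <= K1.
Notation evolve := (evolve p).

Let K_ge0 : 0 <= K. Proof. exact: le_trans (F_bound [ffun=> false]). Qed.

Lemma generator_lin (u : config l -> R) a :
  L u a = \sum_b u b * L (fun c => (c == b)%:R) a.
Proof.
rewrite (generatorE d N_gt0).
under [RHS]eq_bigr do rewrite (generatorE d N_gt0) mulr_sumr.
rewrite exchange_big; apply: eq_bigr => x _ /=.
have E z : u z = \sum_b u b * (z == b)%:R.
  rewrite (bigD1 z) //= eqxx mulr1 big1 ?addr0 // => b bz.
  by rewrite eq_sym (negbTE bz) mulr0.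
rewrite (E (swap_spins x a)) (E a) -sumrB mulr_sumr; apply: eq_bigr => b _; ring.
Qed.

Lemma avg_norm (phi : config l -> R) c :
  (forall eta, `|phi eta| <= c) -> `|avg w phi| <= c.
Proof.
move=> h; apply: le_trans (ler_norm_sum _ _ _) _.
rewrite -[leRHS](avg_const w_sum1) /avg; apply: ler_sum => eta _.
by rewrite normrM ger0_norm // ler_wpM2l.
Qed.

(** The energy balance of one step of du/dt = L u + F. The threshold depends on [u] only through its
    sup bound [c], so it serves all steps at once. *)
Lemma square_step (c s : R) : 0 <= c -> 0 < s -> exists2 h0 : R, 0 < h0 &
  forall h, 0 < h -> h < h0 -> forall u, (forall eta, `|u eta| <= c) ->
  avg w (fun eta => (evolve h u eta + h * F eta) ^+ 2) <=
  avg w (fun eta => u eta ^+ 2) + 2 * h * avg w (fun eta => u eta * L u eta)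
  + 2 * h * avg w (fun eta => F eta * u eta) + h * s.
Proof.
(* This makes the cross term with the expansion error at most h s / 2; the other half is kept for
   the squared increment. *)
move=> c0 s0; pose eps := s / (4 * (c ^+ 2 + 1)).
have c1 : 0 < c ^+ 2 + 1 by rewrite ltr_wpDl ?sqr_ge0.
have eps0 : 0 < eps by rewrite divr_gt0 // mulr_gt0.
pose C := gen_norm L * c + K + eps * c.
have C0 : 0 <= C by rewrite /C; apply: addr_ge0; [apply: addr_ge0 => //|]; apply: mulr_ge0 => //; [apply: gen_norm_ge0|apply: ltW].
have C1 : 0 < C ^+ 2 + 1 by rewrite ltr_wpDl ?sqr_ge0.
have [h1 h10 H] := evolve_expansion p_gen generator_lin eps0.
exists (Num.min h1 (s / (2 * (C ^+ 2 + 1)))).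
  by rewrite lt_min h10 divr_gt0 // mulr_gt0.
move=> h hp; rewrite lt_min => /andP[hh1 hh2] u uc.
have -> : avg w (fun eta => u eta ^+ 2) + 2 * h * avg w (fun eta => u eta * L u eta)
  + 2 * h * avg w (fun eta => F eta * u eta) + h * s =
  avg w (fun eta => u eta ^+ 2 + 2 * h * (u eta * L u eta) + 2 * h * (F eta * u eta) + h * s).
  by rewrite !avgD !avgZ (avg_const w_sum1).
apply: avg_le => // eta.
pose er := evolve h u eta - u eta - h * L u eta.
have erb : `|er| <= eps * h * c by apply: H.
have Lb : `|L u eta| <= gen_norm L * c by apply: gen_bound uc; apply: generator_lin.
pose D := evolve h u eta + h * F eta - u eta.
have Db : `|D| <= h * C.
  have -> : D = h * L u eta + h * F eta + er by rewrite /D /er; ring.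
  have -> : h * C = h * (gen_norm L * c) + h * K + eps * h * c by rewrite /C; ring.
  apply: le_trans (ler_normD _ _) _; rewrite lerD //.
  apply: le_trans (ler_normD _ _) _.
  by rewrite !normrM !(gtr0_norm hp) lerD // ler_wpM2l // ltW.
have D2 : D ^+ 2 <= h * (s / 2).
  apply: (@le_trans _ _ ((h * C) ^+ 2)).
    by rewrite -real_normK ?num_real // ler_pXn2r ?nnegrE // mulr_ge0 // ltW.
  rewrite exprMn expr2 -mulrA ler_wpM2l ?(ltW hp) //.
  move: hh2; rewrite ltr_pdivlMr ?mulr_gt0 // => /ltW hh2.
  have := mulr_ge0 (ltW hp) (sqr_ge0 C); nra.
have ue : 2 * (u eta * er) <= h * (s / 2).
  apply: (@le_trans _ _ (2 * (c * (eps * h * c)))).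
    rewrite ler_wpM2l //; apply: le_trans (ler_norm _) _.
    by rewrite normrM ler_pM.
  have -> : 2 * (c * (eps * h * c)) = h * (s / 2) * (c ^+ 2 / (c ^+ 2 + 1)).
    by rewrite /eps; field; rewrite lt0r_neq0.
  rewrite -[leRHS]mulr1 ler_wpM2l ?mulr_ge0 ?invr_ge0 // ?(ltW hp) ?(ltW s0) //.
  by rewrite ler_pdivrMr // mul1r lerDl.
have -> : (evolve h u eta + h * F eta) ^+ 2 = u eta ^+ 2 + 2 * h * (u eta * L u eta)
   + 2 * h * (F eta * u eta) + 2 * (u eta * er) + D ^+ 2 by rewrite /D /er; ring.
by rewrite -!addrA !lerD2l (le_trans (lerD ue D2)) // -mulrDr -splitr.
Qed.

Definition potential h (m : nat) eta : R := h * \sum_(k < m) evolve (h *+ k) F eta.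

(** Discrete Duhamel recursion, the form of dV/dt = L V + F to which [square_step] applies. *)
Lemma potentialS h m eta : 0 <= h ->
  potential h m.+1 eta = evolve h (potential h m) eta + h * F eta.
Proof.
move=> h0; rewrite /potential big_ord_recl mulr0n mulrDr addrC (evolve0 p_trans); congr (_ + _).
rewrite -[RHS]addr0 (_ : evolve h _ eta = evolve h (fun z => h * (\sum_(k < m) evolve (h *+ k) F z) + 0) eta); last first.
  by apply: eq_bigr => z _; rewrite addr0.
rewrite evolve_lin [X in _ = _ + X + _](_ : _ = 0) ?addr0; last first.
  by rewrite /evolve big1 // => z _; rewrite mulr0.
rewrite evolve_sum; congr (_ * _); apply: eq_bigr => k _ /=.
by rewrite /bump /= add1n mulrS evolveD // mulrn_wge0.
Qed.

Lemma potential_bound h m eta : 0 <= h -> h * m%:R <= T -> `|potential h m eta| <= T * K.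
Proof.
move=> h0 hm; rewrite /potential normrM (ger0_norm h0).
apply: (@le_trans _ _ (h * (m%:R * K))); last by rewrite mulrA ler_wpM2r.
rewrite ler_wpM2l // (le_trans (ler_norm_sum _ _ _)) //.
apply: (@le_trans _ _ (\sum_(k < m) K)); last by rewrite sumr_const card_ord mulr_natl.
by apply: ler_sum => k _; apply: (evolve_norm p_trans) => //; rewrite mulrn_wge0.
Qed.

(** The Gronwall factor of the rate B^2 e over the time T, with e T at most K1. *)
Definition growth : R := expR (B ^+ 2 * K1).

(** Young's inequality, balanced by 4 * 16^-1 * 4 = 1. The coefficient 16^-1 is half of the
    dissipation in [square_form], so half of that survives. *)
Lemma avg_F_dirichlet u :
  avg w (fun eta => F eta * u eta) <= 16^-1 * nu ^+ 2 * dirichlet w u + 4 * sigma2.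
Proof.
have := F_hminus1 u; set x := avg _ _; set D := dirichlet w u => Fh.
have D0 : 0 <= D by apply: sumr_ge0 => z _; apply: bond_energy_ge0.
have Y0 : 0 <= 16^-1 * nu ^+ 2 * D + 4 * sigma2.
  by rewrite addr_ge0 // ?mulr_ge0 ?sqr_ge0 // ltW.
apply: le_trans (ler_norm _) _.
rewrite -[leRHS]ger0_norm // -ler_sqr ?nnegrE // !real_normK ?num_real //.
apply: le_trans Fh _.
have := sqr_ge0 (16^-1 * nu ^+ 2 * D - 4 * sigma2); nra.
Qed.

(** The surviving dissipation [h * D m] is used twice: discarded, it leaves a Gronwall recursion for
    the energy; telescoped, it bounds the time-summed Dirichlet form and, through [GD], the sum of
    the averages of F V. *)
Lemma potential_energy : exists2 h0 : R, 0 < h0 &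
  forall h, 0 < h -> h < h0 -> forall M : nat, h * M%:R <= T ->
  (forall m, (m <= M)%N -> avg w (fun eta => potential h m eta ^+ 2) <= 9 * growth * (T * sigma2)) /\
  h * (\sum_(m < M) avg w (fun eta => F eta * potential h m eta)) <=
    ((9 + 9 * B ^+ 2 * K1 * growth) / 2 + 4) * (T * sigma2).
Proof.
have TK : 0 <= T * K by rewrite mulr_ge0 // ltW.
have [h0 h00 step] := square_step TK sigma2_gt0; exists h0 => // h hp hh0 M hM.
pose a m := avg w (fun eta => potential h m eta ^+ 2).
pose D m := 8^-1 * nu ^+ 2 * dirichlet w (potential h m).
pose G m := avg w (fun eta => F eta * potential h m eta).
have beta0 : 0 <= B ^+ 2 * e by rewrite mulr_ge0 ?sqr_ge0.
have D0 m : 0 <= D m.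
  rewrite mulr_ge0 ?mulr_ge0 ?sqr_ge0 //.
  by apply: sumr_ge0 => z _; apply: bond_energy_ge0.
have GD m : G m <= D m / 2 + 4 * sigma2.
  by have := avg_F_dirichlet (potential h m); rewrite /G /D; lra.
have hm m : (m <= M)%N -> h * m%:R <= T.
  by move=> mM; apply: le_trans hM; rewrite ler_wpM2l ?(ltW hp) // ler_nat.
(* Of the 9, 8 is twice the 4 in [GD], and 1 is the error of [square_step] taken with s = sigma2. *)
have st m : (m < M)%N -> a m.+1 + h * D m <= (1 + h * (B ^+ 2 * e)) * a m + h * (9 * sigma2).
  move=> mM.
  have := step h hp hh0 (potential h m) (fun eta => potential_bound eta (ltW hp) (hm m (ltnW mM))).
  rewrite (@avg_ext _ _ _ _ (fun eta => potential h m.+1 eta ^+ 2)); last first.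
    by move=> eta; rewrite potentialS // ltW.
  rewrite -/(a m.+1) -/(a m) -/(G m).
  have := square_form w_ge0 w_count N_gt0 d_bound (potential h m); rewrite -/(a m).
  set q := avg w _ => sq s1.
  have {}sq : q <= - D m + 2^-1 * B ^+ 2 * e * a m by apply: le_trans sq _; rewrite /D; lra.
  have s2 := ler_wpM2l (ltW hp) sq; have s3 := ler_wpM2l (ltW hp) (GD m).
  nra.
have a0 : a 0%N <= 0.
  by rewrite /a /avg big1 // => eta _; rewrite /potential big_ord0 mulr0 expr0n mulr0.
have ag m : (m <= M)%N -> a m <= 9 * growth * (T * sigma2).
  move=> mM.
  have H := discrete_gronwall (q := h * (B ^+ 2 * e)) (c := h * (9 * sigma2)) (M := M)
    (mulr_ge0 (ltW hp) beta0) _ a0 _ mM.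
  apply: le_trans (H _ _) _ => [|k kM|]; first by rewrite !mulr_ge0 // ltW.
    by apply: le_trans (st k kM); rewrite lerDl mulr_ge0 // ltW.
  have -> : m%:R * (h * (9 * sigma2)) * expR (h * (B ^+ 2 * e) * m%:R) =
    9 * (h * m%:R * sigma2 * expR (B ^+ 2 * (e * (h * m%:R)))).
    by rewrite [h * (B ^+ 2 * e) * m%:R](_ : _ = B ^+ 2 * (e * (h * m%:R))); ring.
  have -> : 9 * growth * (T * sigma2) = 9 * (T * sigma2 * growth) by ring.
  rewrite ler_wpM2l // ler_pM ?expR_ge0 ?mulr_ge0 ?(ltW hp) ?(ltW sigma2_gt0) //.
    by rewrite ler_wpM2r ?(ltW sigma2_gt0) // hm.
  rewrite ler_expR ler_wpM2l ?sqr_ge0 // (le_trans _ eT_le) // ler_wpM2l // hm //.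
split=> //.
have a_ge0 m : 0 <= a m by apply: avg_ge0 => // eta; apply: sqr_ge0.
pose A := 9 * growth * (T * sigma2).
have tel k : (k <= M)%N -> h * (\sum_(m < k) D m) <= h * k%:R * (B ^+ 2 * e * A + 9 * sigma2) - a k.
  elim: k => [|k IH] kM.
    by rewrite big_ord0 !mulr0 mul0r sub0r oppr_ge0.
  rewrite big_ord_recr /= mulrDr -natr1.
  have := st k kM; have := IH (ltnW kM).
  have := ler_wpM2l (mulr_ge0 (ltW hp) beta0) (ag k (ltnW kM)); rewrite -/A; nra.
have bA : h * M%:R * (B ^+ 2 * e * A + 9 * sigma2) <= (9 + 9 * B ^+ 2 * K1 * growth) * (T * sigma2).
  have g0 : 0 <= growth by apply: expR_ge0.
  have A0 : 0 <= A by rewrite !mulr_ge0 // ltW.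
  apply: (@le_trans _ _ (T * (B ^+ 2 * e * A + 9 * sigma2))).
    apply: ler_wpM2r => //; apply: addr_ge0; last by rewrite mulr_ge0 // ltW.
    by rewrite mulr_ge0.
  have -> : T * (B ^+ 2 * e * A + 9 * sigma2) = e * T * (B ^+ 2 * A) + 9 * (T * sigma2) by ring.
  have -> : (9 + 9 * B ^+ 2 * K1 * growth) * (T * sigma2) = K1 * (B ^+ 2 * A) + 9 * (T * sigma2).
    by rewrite /A; ring.
  by rewrite lerD2r ler_wpM2r // mulr_ge0 ?sqr_ge0.
have telM := le_trans (tel M (leqnn M)) (_ : _ <= h * M%:R * (B ^+ 2 * e * A + 9 * sigma2)).
have {}telM := telM (_ : _).
have {}telM : h * (\sum_(m < M) D m) <= (9 + 9 * B ^+ 2 * K1 * growth) * (T * sigma2).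
  apply: le_trans bA; apply: telM.
  by rewrite gerBl.
have sG : \sum_(m < M) G m <= (\sum_(m < M) D m) / 2 + M%:R * (4 * sigma2).
  rewrite mulr_suml (_ : M%:R * _ = \sum_(m < M) 4 * sigma2); last by rewrite sumr_const card_ord mulr_natl.
  by rewrite -big_split ler_sum.
have := ler_wpM2l (ltW hp) sG.
have := ler_wpM2r (ltW sigma2_gt0) hM.
rewrite -/G; lra.
Qed.

End DiscreteEnergy.

(** * Density of the law at time t and its fourth moment *)

Section Density.
Variables (R : realType) (l : nat) (w : config l -> R).
Hypothesis w_ge0 : forall eta, 0 <= w eta.
Hypothesis w_count : forall eta zeta : config l,
  #|[set x | eta x]| = #|[set x | zeta x]| -> w eta = w zeta.
Hypothesis w_sum1 : \sum_eta w eta = 1.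
Variables (N : nat) (d : (int -> bool) -> R) (B : R).
Hypothesis N_gt0 : (0 < N)%N.
Hypothesis d_bound : forall eta, `|d eta| <= B.
Notation L := (@generator R N l d).
Notation nu := (N%:R : R).
Notation e := (l.+1%:R : R).
Variable p : R -> config l -> config l -> R.
Hypothesis p_trans : transition_function p.
Hypothesis p_gen : has_generator p L.
Variables (T K1 : R).
Hypothesis T_gt0 : 0 < T.
Hypothesis eT_le : e * T <= K1.
Notation evolve := (evolve p).

(* Off the support of w this is x / 0 = 0; nothing is lost there, because the
   dynamics preserves the particle number (see [density_avg]). *)
Definition density t a : R := (\sum_b w b * p t b a) / w a.

Lemma density_avg t u : 0 <= t ->
  avg w (fun a => density t a * u a) = avg w (evolve t u).
Proof.
move=> t0.
(* The indicator of the zero set of [w] is unchanged by every exchange, hence annihilated by [L] and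
   conserved: no mass enters that set. *)
have supp a : w a = 0 -> \sum_b w b * p t b a = 0.
  move=> wa; pose z := fun c : config l => (w c == 0)%:R : R.
  have Lz c : L z c = 0.
    rewrite (generatorE d N_gt0) big1 // => x _.
    by rewrite /z (w_xchg w_count x (x + step l) c : w (swap_spins x c) = w c) subrr mulr0.
  apply: big1 => b _; have [->|wb] := eqVneq (w b) 0; first by rewrite mul0r.
  have := evolve_invariant p_trans p_gen (generator_lin d N_gt0) (u := z) b t0 Lz.
  rewrite /z (negbTE wb) => /eqP; rewrite psumr_eq0 => [|c _]; last first.
    by rewrite mulr_ge0 // (tf_ge0 p_trans).
  by move/allP/(_ a (mem_index_enum _)); rewrite wa eqxx mulr1 => /eqP ->; rewrite mulr0.
transitivity (\sum_a (\sum_b w b * p t b a) * u a).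
  apply: eq_bigr => a _; rewrite /density mulrA; congr (_ * _).
  have [wa|wa] := eqVneq (w a) 0; first by rewrite supp // mul0r mulr0.
  by rewrite mulrC divfK.
under eq_bigr do rewrite mulr_suml.
rewrite exchange_big; apply: eq_bigr => b _; rewrite mulr_sumr.
by apply: eq_bigr => a _; rewrite mulrA.
Qed.

Lemma density_ge0 t a : 0 <= t -> 0 <= density t a.
Proof.
move=> t0; rewrite divr_ge0 // sumr_ge0 // => b _.
by rewrite mulr_ge0 // (tf_ge0 p_trans).
Qed.

Lemma density_mass t : 0 <= t -> avg w (density t) = 1.
Proof.
move=> t0; rewrite -[LHS](@avg_ext _ _ _ (fun a => density t a * 1)); last by move=> a; rewrite mulr1.
rewrite density_avg // -[RHS](avg_const w_sum1); apply: avg_ext => a.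
by rewrite /evolve; under eq_bigr do rewrite mulr1; rewrite (tf_sum1 p_trans).
Qed.

(** A crude bound that grows with the state space; it enters the threshold on the time step and no
    final constant. *)
Definition density_sup : R := \sum_a (w a)^-1.

Lemma density_bound t a : 0 <= t -> `|density t a| <= density_sup.
Proof.
move=> t0; rewrite ger0_norm ?density_ge0 //.
apply: (@le_trans _ _ (w a)^-1); last first.
  by rewrite /density_sup (bigD1 a) //= lerDl sumr_ge0 // => b _; rewrite invr_ge0.
rewrite /density -[leRHS]mul1r ler_wpM2r ?invr_ge0 // -w_sum1 ler_sum // => b _.
rewrite -[leRHS]mulr1 ler_wpM2l // -(tf_sum1 p_trans b t0) (bigD1 a) //= lerDl.
by rewrite sumr_ge0 // => c _; rewrite (tf_ge0 p_trans).
Qed.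

Lemma density0 a : w a != 0 -> density 0 a = 1.
Proof.
move=> wa; rewrite /density (bigD1 a) //= (tf_0 p_trans) eqxx mulr1 big1 ?addr0 ?divff // => b ba.
by rewrite (tf_0 p_trans) (negbTE ba) mulr0.
Qed.

Definition excess h m a : R := density (h *+ m) a - 1.

(** The forward equation in weak form: the step is moved onto the test function, and the sup-norm
    error survives averaging because the density has mass 1. *)
Lemma density_step (eps h c : R) (v : config l -> R) m : 0 <= h ->
  (forall a, `|evolve h v a - v a - h * L v a| <= eps * h * c) ->
  `|avg w (fun a => (excess h m.+1 a - excess h m a) * v a)
    - h * avg w (fun a => density (h *+ m) a * L v a)| <= eps * h * c.
Proof.
move=> h0 H; have hm k : 0 <= h *+ k by rewrite mulrn_wge0.
have -> : avg w (fun a => (excess h m.+1 a - excess h m a) * v a) =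
    avg w (fun a => density (h *+ m) a * (evolve h v a - v a)).
  rewrite (@avg_ext _ _ _ _ (fun a => density (h *+ m.+1) a * v a + (-1) * (density (h *+ m) a * v a))); last first.
    by move=> a; rewrite /excess; ring.
  rewrite [RHS](@avg_ext _ _ _ _ (fun a => density (h *+ m) a * evolve h v a + (-1) * (density (h *+ m) a * v a))); last first.
    by move=> a; ring.
  rewrite !avgD !avgZ !density_avg //; congr (_ + _).
  by apply: avg_ext => a; rewrite mulrSr evolveD.
rewrite -avgZ -[X in _ - X]mul1r -mulNr -avgZ -avgD.
rewrite (@avg_ext _ _ _ _ (fun a => density (h *+ m) a * (evolve h v a - v a - h * L v a))); last first.
  by move=> a; ring.
apply: le_trans (ler_norm_sum _ _ _) _.
rewrite -[leRHS]mul1r -(density_mass (hm m)) mulr_suml; apply: ler_sum => a _.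
rewrite normrM (ger0_norm (w_ge0 a)) normrM (ger0_norm (density_ge0 a (hm m))) mulrA.
by apply: ler_wpM2l => //; apply: mulr_ge0 => //; apply: density_ge0.
Qed.

Lemma density_avg_norm t (v : config l -> R) c : 0 <= t -> (forall a, `|v a| <= c) ->
  `|avg w (fun a => density t a * v a)| <= c.
Proof.
move=> t0 vc; rewrite density_avg //; apply: avg_norm => // a.
exact: (evolve_norm p_trans).
Qed.

(* An implicit scheme: convexity gives r^4 <= k^4 + 4 r^3 (r - k) for the new value
   r and the old value k, so that no second-order term in the time step appears. *)
Lemma quartic_step (s : R) : 0 < s -> exists2 h0 : R, 0 < h0 &
  forall h, 0 < h -> h < h0 -> forall m,
  avg w (fun a => excess h m.+1 a ^+ 4) <= avg w (fun a => excess h m a ^+ 4) +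
    4 * h * avg w (fun a => (1 + excess h m.+1 a) * L (fun z => excess h m.+1 z ^+ 3) a) + h * s.
Proof.
move=> s0; pose U := (density_sup + 1) ^+ 3; pose G := @gen_norm R (config l) L.
have G0 : 0 <= G by apply: gen_norm_ge0.
have D0 : 0 <= density_sup by rewrite sumr_ge0 // => a _; rewrite invr_ge0.
have U0 : 0 <= U by rewrite exprn_ge0 // addr_ge0.
pose eps := s / (8 * (U + 1)).
have U1 : 0 < U + 1 by rewrite ltr_wpDl.
have eps0 : 0 < eps by rewrite divr_gt0 // mulr_gt0.
pose C := G * (G * U) + eps * (G * U).
have C0 : 0 <= C by rewrite /C -mulrDl !mulr_ge0 // addr_ge0 // ltW.
have [h1 h10 H] := evolve_expansion p_gen (generator_lin d N_gt0) eps0.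
have C1 : 0 < C + 1 by rewrite ltr_wpDl.
exists (Num.min h1 (s / (8 * (C + 1)))).
  by rewrite lt_min h10 divr_gt0 // mulr_gt0.
move=> h hp; rewrite lt_min => /andP[hh1 hh2] m; pose r := excess h m.+1.
have h0 := ltW hp.
have hm k : 0 <= h *+ k by rewrite mulrn_wge0.
pose k := excess h m.
have rU a : `|r a ^+ 3| <= U.
  rewrite normrX; apply: lerXn2r; rewrite ?nnegrE ?addr_ge0 //.
  by rewrite (le_trans (ler_normB _ _)) // normr1 lerD2r density_bound.
pose v a := r a ^+ 3.
have LU a : `|L v a| <= G * U by apply: gen_bound rU; apply: generator_lin.
have dv := density_step m h0 (fun a => H h hp hh1 v U a rU).
(* The test function is built from the new density while the old one is paired with [L v]; testing
   the increment against [L v] as well shows that this mismatch is O(h). *)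
have dLv := density_step m h0 (fun a => H h hp hh1 (L v) (G * U) a LU).
have bLLv : `|avg w (fun a => density (h *+ m) a * L (L v) a)| <= G * (G * U).
  by apply: density_avg_norm => // a; apply: gen_bound LU; apply: generator_lin.
set P := avg w (fun a => (1 + r a) * L v a).
have split : avg w (fun a => density (h *+ m) a * L v a) =
    P - avg w (fun a => (r a - k a) * L v a).
  rewrite -[X in _ - X]mul1r -mulNr -avgZ -avgD; apply: avg_ext => a.
  by rewrite /r /k /excess; ring.
have bd : `|avg w (fun a => (r a - k a) * L v a)| <= h * C.
  set q := avg w (fun a => density (h *+ m) a * L (L v) a) in dLv bLLv.
  rewrite -[X in `|X|](subrK (h * q)).
  apply: le_trans (ler_normD _ _) _; apply: le_trans (lerD dLv (lexx _)) _.
  rewrite normrM (ger0_norm h0) /C.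
  have := ler_wpM2l h0 bLLv; lra.
have conv : avg w (fun a => r a ^+ 4) <= avg w (fun a => k a ^+ 4) +
    4 * avg w (fun a => (r a - k a) * v a).
  rewrite -avgZ -avgD; apply: avg_le => // a; rewrite -subr_ge0 /v.
  rewrite (_ : _ - _ = (r a - k a) ^+ 2 * ((r a + k a) ^+ 2 + 2 * r a ^+ 2)); last by ring.
  by rewrite mulr_ge0 ?sqr_ge0 // addr_ge0 ?sqr_ge0 // mulr_ge0 ?sqr_ge0.
have {}dv : avg w (fun a => (r a - k a) * v a) <= h * (P + h * C) + eps * h * U.
  rewrite split in dv; move: dv bd; set x := avg w (fun a => (r a - k a) * v a).
  set y := avg w (fun a => (r a - k a) * L v a) => dv /ler_normlP[bd _].
  move/ler_normlP: dv => [_ dv]; have := ler_wpM2l h0 bd; nra.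
rewrite -/r -/k -/v -/P; apply: le_trans conv _; rewrite -addrA lerD2l.
apply: (@le_trans _ _ (4 * (h * (P + h * C) + eps * h * U))); first by rewrite ler_pM2l.
have e1 : eps * U <= s / 8.
  have -> : eps * U = s / 8 * (U / (U + 1)) by rewrite /eps; field; rewrite lt0r_neq0.
  by rewrite -[leRHS]mulr1 ler_wpM2l ?divr_ge0 ?(ltW s0) // ler_pdivrMr // mul1r lerDl.
have e2 : h * C <= s / 8.
  move: hh2; rewrite ltr_pdivlMr ?mulr_gt0 // => /ltW hh2; nra.
have := ler_wpM2l h0 e1; have := ler_wpM2l h0 e2; nra.
Qed.

Definition quartic_const : R := 2 * (36 * B ^+ 2 + 1) * expR (2 * (9 * B ^+ 2 + 36 * B ^+ 2 * K1)).

(** From zero excess, a source of rate e^2 T acts for a time at most T while the growth rate is of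
    order 1/T: hence (e T)^2. *)
Lemma quartic_bound : exists2 h0 : R, 0 < h0 &
  forall h, 0 < h -> h < h0 -> forall m, h * m%:R <= T ->
  avg w (fun a => excess h m a ^+ 4) <= quartic_const * (e * T) ^+ 2.
Proof.
have ep : 0 < e by rewrite ltr0n.
have s0 : 0 < e ^+ 2 * T by rewrite mulr_gt0 // exprn_gt0.
have [h1 h10 step] := quartic_step s0.
have K10 : 0 <= K1 by apply: le_trans eT_le; rewrite mulr_ge0 // ltW.
pose bb := 9 * B ^+ 2 + 36 * B ^+ 2 * K1.
have bb0 : 0 <= bb by rewrite /bb; have := mulr_ge0 (sqr_ge0 B) K10; have := sqr_ge0 B; lra.
pose lam := bb / T.
have lam0 : 0 <= lam by rewrite divr_ge0 // ltW.
pose gam := (36 * B ^+ 2 + 1) * (e ^+ 2 * T).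
have gam0 : 0 <= gam by rewrite mulr_ge0 ?(ltW s0) // addr_ge0 // mulr_ge0 ?sqr_ge0.
exists (Num.min h1 (2 * (lam + 1))^-1).
  by rewrite lt_min h10 invr_gt0 mulr_gt0 // ltr_wpDl.
move=> h hp; rewrite lt_min => /andP[hh1 hh2] m hm.
have hl : h * lam <= 2^-1.
  move: hh2; rewrite -[X in h < X]mul1r ltr_pdivlMr ?mulr_gt0 ?ltr_wpDl //; nra.
pose y j := avg w (fun a => excess h j a ^+ 4).
have y_ge0 j : 0 <= y j.
  by apply: avg_ge0 => // a; rewrite (_ : _ ^+ 4 = (excess h j a ^+ 2) ^+ 2) ?sqr_ge0 //; ring.
have y0 : y 0%N <= 0.
  rewrite /y /avg big1 // => a _; have [->|wa] := eqVneq (w a) 0; first by rewrite mul0r.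
  by rewrite /excess mulr0n density0 // subrr expr0n mulr0.
have st j : y j.+1 <= (1 + 2 * (h * lam)) * y j + 2 * (h * gam).
  have := step h hp hh1 j; set r := excess h j.+1.
  rewrite -/(y j.+1) -/(y j) => s1.
  have cf := cube_form w_ge0 w_count N_gt0 d_bound r.
  (* The weight e T balances Young's inequality: after multiplication by e, the quadratic term
     becomes the source e^2 T plus a rate of order 1/T on the quartic one. *)
  have r2 : avg w (fun a => r a ^+ 2) <= e * T + (4 * (e * T))^-1 * y j.+1.
    have eT : 0 < e * T by rewrite mulr_gt0.
    rewrite -[X in X + _](avg_const w_sum1) -avgZ -avgD; apply: avg_le => // a /=; rewrite -/r.
    rewrite -subr_ge0 (_ : _ - _ = (4 * (e * T))^-1 * (r a ^+ 2 - 2 * (e * T)) ^+ 2).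
      by rewrite mulr_ge0 ?sqr_ge0 // invr_ge0 mulr_ge0 // ltW.
    by move: (e) ep => e0 ep; field; rewrite (lt0r_neq0 T_gt0) (lt0r_neq0 ep).
  have key : 4 * (9 * B ^+ 2 * e * (avg w (fun a => r a ^+ 2) + y j.+1)) <=
      36 * B ^+ 2 * (e ^+ 2 * T) + lam * y j.+1.
    have b0 : 0 <= 36 * B ^+ 2 * e by rewrite mulr_ge0 ?(ltW ep) // mulr_ge0 ?sqr_ge0.
    have k1 := ler_wpM2l b0 r2.
    have k2 : 36 * B ^+ 2 * e * ((4 * (e * T))^-1 * y j.+1) = 9 * B ^+ 2 / T * y j.+1.
      by move: (e) ep => e0 ep; field; rewrite (lt0r_neq0 T_gt0) (lt0r_neq0 ep).
    have k3 : 36 * B ^+ 2 * e * y j.+1 <= 36 * B ^+ 2 * K1 / T * y j.+1.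
      have q : e <= K1 / T by rewrite ler_pdivlMr.
      apply: ler_wpM2r => //; rewrite -[leRHS]mulrA; apply: ler_wpM2l q.
      by rewrite mulr_ge0 ?sqr_ge0.
    have -> : lam = 9 * B ^+ 2 / T + 36 * B ^+ 2 * K1 / T by rewrite /lam /bb mulrDl.
    rewrite mulrDr k2 in k1; rewrite mulrDl; lra.
  have cf2 := ler_wpM2l (ltW hp) cf.
  have key2 := ler_wpM2l (ltW hp) key.
  have imp : y j.+1 * (1 - h * lam) <= y j + h * gam.
    rewrite /gam; move: s1 cf2 key2; rewrite -/(y j.+1); set P := avg w (fun a => (1 + r a) * _).
    set Q := avg w (fun a => r a ^+ 2); nra.
  have hl0 : 0 <= h * lam by rewrite mulr_ge0 // ltW.
  have f1 : 0 <= 1 + 2 * (h * lam) by rewrite addr_ge0 // mulr_ge0.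
  have i2 := ler_wpM2r f1 imp.
  (* (1 - x) (1 + 2 x) is at least 1 for x between 0 and 1/2, which solves the implicit inequality
     for the new value. *)
  have i3 : y j.+1 <= y j.+1 * (1 - h * lam) * (1 + 2 * (h * lam)).
    rewrite -mulrA -[leLHS]mulr1 ler_wpM2l //; nra.
  have i4 : h * gam * (1 + 2 * (h * lam)) <= 2 * (h * gam).
    by rewrite mulrC; apply: ler_wpM2r; [apply: mulr_ge0 => //; apply: ltW|lra].
  rewrite mulrDl in i2; lra.
have q0 : 0 <= 2 * (h * lam) by rewrite mulr_ge0 // mulr_ge0 // ltW.
have c0 : 0 <= 2 * (h * gam).
  by apply: mulr_ge0 => //; apply: mulr_ge0 => //; apply: ltW.
apply: le_trans (discrete_gronwall q0 c0 y0 (fun j _ => st j) (leqnn m)) _.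
have -> : quartic_const * (e * T) ^+ 2 = T * (2 * gam) * expR (2 * bb).
  by rewrite /quartic_const /gam -/bb; ring.
have g0 : 0 <= 2 * gam by apply: mulr_ge0.
have -> : m%:R * (2 * (h * gam)) = h * m%:R * (2 * gam) by ring.
apply: ler_pM; rewrite ?expR_ge0 //.
- by apply: mulr_ge0 => //; apply: mulr_ge0 => //; apply: ltW.
- exact: ler_wpM2r.
rewrite ler_expR (_ : bb = lam * T); last by rewrite /lam divfK // lt0r_neq0.
have := ler_wpM2l lam0 hm; lra.
Qed.

End Density.

(** A symmetric double sum reordered by lag. The diagonal is counted twice on the right, whence the
    sign condition. *)
Lemma sum_minmax_le (R : realDomainType) (c : nat -> nat -> R) (M : nat) :
  (forall i, 0 <= c i i) ->
  \sum_(i < M) \sum_(j < M) c (minn i j) (maxn i j) <=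
  2 * \sum_(i < M) \sum_(k < M - i) c i (i + k)%N.
Proof.
move=> c0; elim: M => [|M IH]; first by rewrite !big_ord0 mulr0.
have -> : \sum_(i < M.+1) \sum_(j < M.+1) c (minn i j) (maxn i j) =
    \sum_(i < M) \sum_(j < M) c (minn i j) (maxn i j) + 2 * \sum_(i < M) c i M + c M M.
  rewrite big_ord_recr /=.
  under eq_bigr do rewrite big_ord_recr /=.
  rewrite big_split /= big_ord_recr /= minnn maxnn.
  have -> : \sum_(i < M) c (minn i M) (maxn i M) = \sum_(i < M) c i M.
    by apply: eq_bigr => i _; rewrite (minn_idPl (ltnW (ltn_ord i))) (maxn_idPr (ltnW (ltn_ord i))).
  have -> : \sum_(i < M) c (minn M i) (maxn M i) = \sum_(i < M) c i M.
    by apply: eq_bigr => i _; rewrite (minn_idPr (ltnW (ltn_ord i))) (maxn_idPl (ltnW (ltn_ord i))).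
  by ring.
have -> : \sum_(i < M.+1) \sum_(k < M.+1 - i) c i (i + k)%N =
    \sum_(i < M) \sum_(k < M - i) c i (i + k)%N + \sum_(i < M) c i M + c M M.
  rewrite big_ord_recr /= subSnn big_ord1 addn0 -big_split; congr (_ + _).
  apply: eq_bigr => i _; rewrite subSn ?(ltnW (ltn_ord i)) // big_ord_recr /=.
  by rewrite subnKC // ltnW.
have := c0 M; lra.
Qed.

(** * Second moment of the sum over a time grid *)

Section DiscreteVariance.
Variables (R : realType) (l : nat) (w : config l -> R).
Hypothesis w_ge0 : forall eta, 0 <= w eta.
Hypothesis w_count : forall eta zeta : config l,
  #|[set x | eta x]| = #|[set x | zeta x]| -> w eta = w zeta.
Hypothesis w_sum1 : \sum_eta w eta = 1.
Variables (N : nat) (d : (int -> bool) -> R) (B : R).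
Hypothesis N_gt0 : (0 < N)%N.
Hypothesis d_bound : forall eta, `|d eta| <= B.
Notation L := (@generator R N l d).
Notation nu := (N%:R : R).
Notation e := (l.+1%:R : R).
Variable p : R -> config l -> config l -> R.
Hypothesis p_trans : transition_function p.
Hypothesis p_gen : has_generator p L.
Variables (F : config l -> R) (K sigma2 : R).
Hypothesis F_bound : forall eta, `|F eta| <= K.
Hypothesis sigma2_gt0 : 0 < sigma2.
Hypothesis F_hminus1 : forall u,
  avg w (fun eta => F eta * u eta) ^+ 2 <= nu ^+ 2 * sigma2 * dirichlet w u.
Variables (T K1 K2 : R).
Hypothesis T_gt0 : 0 < T.
Hypothesis eT_le : e * T <= K1.
Hypothesis K2_ge0 : 0 <= K2.
Hypothesis F_quartic :
  (e * T) ^+ 2 * T ^+ 2 * avg w (fun eta => F eta ^+ 4) <= K2 * sigma2 ^+ 2.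
Notation evolve := (evolve p).

(** For i <= j, the correlation of F at the grid times h (i + 1) and h (j + 1); the shift by one
    reflects sampling at right endpoints. *)
Definition two_time h i j : R :=
  avg w (evolve (h *+ i.+1) (fun a => F a * evolve (h *+ (j - i)) F a)).

(** The 81 is the square of the 9 in the energy bound; the added 1 makes the constant at least its
    own fourth root. *)
Definition excess_const : R := 1 + 81 * quartic_const B K1 * growth B K1 ^+ 2 * K2.

Lemma quartic_const_ge0 : 0 <= quartic_const B K1.
Proof.
by rewrite /quartic_const !mulr_ge0 ?expR_ge0 // addr_ge0 // mulr_ge0 ?sqr_ge0.
Qed.

Lemma excess_const_ge1 : 1 <= excess_const.
Proof.
rewrite lerDl; apply: mulr_ge0 => //; apply: mulr_ge0; last exact: sqr_ge0.
by apply: mulr_ge0 => //; apply: quartic_const_ge0.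
Qed.

(** Summing over the lag rebuilds the potential, and the law at the earlier time contributes the
    density 1 + excess. *)
Lemma two_time_sum h i m : 0 <= h ->
  h * (\sum_(k < m) two_time h i (i + k)) =
  avg w (fun a => F a * potential p F h m a) +
  avg w (fun a => excess w p h i.+1 a * (F a * potential p F h m a)).
Proof.
move=> h0.
have -> : h * (\sum_(k < m) two_time h i (i + k)) =
    avg w (evolve (h *+ i.+1) (fun a => F a * potential p F h m a)).
  rewrite /two_time -avg_sum -avgZ; apply: avg_ext => a.
  rewrite -evolve_sum /evolve mulr_sumr; apply: eq_bigr => b _.
  rewrite /potential -mulr_sumr mulrCA; congr (_ * _); rewrite mulrCA; congr (_ * _).
  by congr (_ * _); apply: eq_bigr => k _; rewrite addKn.
rewrite -(density_avg w_count N_gt0 p_trans p_gen) ?mulrn_wge0 // -avgD.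
by apply: avg_ext => a; rewrite /excess; ring.
Qed.

(* The fourth powers of both sides are compared, with
   <k F V>^4 <= <k^4> <F^4> <V^2>^2. *)
Lemma excess_term (k V : config l -> R) :
  avg w (fun a => k a ^+ 4) <= quartic_const B K1 * (e * T) ^+ 2 ->
  avg w (fun a => V a ^+ 2) <= 9 * growth B K1 * (T * sigma2) ->
  avg w (fun a => k a * (F a * V a)) <= excess_const * sigma2.
Proof.
move=> k4 V2; set X := avg _ _.
have q0 := quartic_const_ge0.
have g0 : 0 <= growth B K1 by apply: expR_ge0.
have c1 := excess_const_ge1.
have s0 := ltW sigma2_gt0.
have V0 : 0 <= avg w (fun a => V a ^+ 2) by apply: avg_ge0 => // a; apply: sqr_ge0.
have kF0 : 0 <= avg w (fun a => (k a * F a) ^+ 2) by apply: avg_ge0 => // a; apply: sqr_ge0.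
have pow4 (u : R) : u ^+ 4 = (u ^+ 2) ^+ 2 by rewrite -exprM.
have F0 : 0 <= avg w (fun a => F a ^+ 4) by apply: avg_ge0 => // a; rewrite pow4 sqr_ge0.
have k0 : 0 <= avg w (fun a => k a ^+ 4) by apply: avg_ge0 => // a; rewrite pow4 sqr_ge0.
have cs1 : X ^+ 2 <= avg w (fun a => (k a * F a) ^+ 2) * avg w (fun a => V a ^+ 2).
  rewrite /X (@avg_ext _ _ _ _ (fun a => (k a * F a) * V a)); last by move=> a; ring.
  exact: avg_cauchy_schwarz.
have cs2 : avg w (fun a => (k a * F a) ^+ 2) ^+ 2 <=
    avg w (fun a => k a ^+ 4) * avg w (fun a => F a ^+ 4).
  rewrite (@avg_ext _ _ _ _ (fun a => k a ^+ 2 * F a ^+ 2)); last by move=> a; ring.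
  apply: le_trans (avg_cauchy_schwarz w_ge0 _ _) _.
  by rewrite le_eqVlt; apply/orP; left; apply/eqP; congr (_ * _); apply: avg_ext => a; rewrite -exprM.
have X4 : X ^+ 4 <= excess_const ^+ 4 * sigma2 ^+ 4.
  rewrite pow4; apply: le_trans (_ : _ <= (avg w (fun a => k a ^+ 4) * avg w (fun a => F a ^+ 4)) * avg w (fun a => V a ^+ 2) ^+ 2) _.
    apply: le_trans (_ : _ <= (avg w (fun a => (k a * F a) ^+ 2) * avg w (fun a => V a ^+ 2)) ^+ 2) _.
      by rewrite ler_sqr ?nnegrE ?sqr_ge0 ?mulr_ge0.
    by rewrite exprMn ler_wpM2r ?sqr_ge0.
  apply: le_trans (_ : _ <= (quartic_const B K1 * (e * T) ^+ 2 * avg w (fun a => F a ^+ 4)) * (9 * growth B K1 * (T * sigma2)) ^+ 2) _.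
    apply: ler_pM; rewrite ?sqr_ge0 ?mulr_ge0 //; first by rewrite ler_wpM2r.
    by rewrite ler_sqr ?nnegrE // (le_trans V0 V2).
  have -> : quartic_const B K1 * (e * T) ^+ 2 * avg w (fun a => F a ^+ 4) * (9 * growth B K1 * (T * sigma2)) ^+ 2
    = 81 * quartic_const B K1 * growth B K1 ^+ 2 * sigma2 ^+ 2 * ((e * T) ^+ 2 * T ^+ 2 * avg w (fun a => F a ^+ 4)).
    move: (e) (avg w _) => e0 A0; ring.
  have P0 : 0 <= 81 * quartic_const B K1 * growth B K1 ^+ 2.
    by apply: mulr_ge0; [apply: mulr_ge0|apply: sqr_ge0].
  apply: le_trans (ler_wpM2l (mulr_ge0 P0 (sqr_ge0 sigma2)) F_quartic) _.
  have -> : 81 * quartic_const B K1 * growth B K1 ^+ 2 * sigma2 ^+ 2 * (K2 * sigma2 ^+ 2) =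
     (81 * quartic_const B K1 * growth B K1 ^+ 2 * K2) * sigma2 ^+ 4 by ring.
  rewrite ler_wpM2r ?pow4 ?sqr_ge0 // -pow4.
  apply: le_trans (_ : _ <= excess_const) _; first by rewrite /excess_const lerDr.
  by rewrite -[leLHS]expr1; apply: ler_weXn2l.
have c0 : 0 <= excess_const * sigma2 by rewrite mulr_ge0 // (le_trans _ c1).
apply: le_trans (ler_norm _) _.
rewrite -(@ler_pXn2r _ 4) ?nnegrE // exprMn.
by rewrite -normrX ger0_norm // pow4 sqr_ge0.
Qed.

Definition variance_const : R :=
  2 * ((9 + 9 * B ^+ 2 * K1 * growth B K1) / 2 + 4 + excess_const).

Lemma discrete_variance : exists2 h0 : R, 0 < h0 &
  forall h, 0 < h -> h < h0 -> forall M : nat, h * M.+1%:R <= T ->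
  h ^+ 2 * (\sum_(i < M) \sum_(j < M) two_time h (minn i j) (maxn i j)) <=
  variance_const * (T * sigma2).
Proof.
have [h1 h10 HV] := potential_energy w_ge0 w_count w_sum1 N_gt0 d_bound p_trans p_gen F_bound sigma2_gt0 F_hminus1 T_gt0 eT_le.
have [h2 h20 Hk] := quartic_bound w_ge0 w_count w_sum1 N_gt0 d_bound p_trans p_gen T_gt0 eT_le.
exists (Num.min h1 h2); first by rewrite lt_min h10.
move=> h hp; rewrite lt_min => /andP[hh1 hh2] M hM.
have h0 := ltW hp.
(* Taken with M + 1 steps, so that [FVb] covers m = 0, ..., M: the term m = 0 vanishes and the
   others are, in reverse, the remaining horizons M - i. *)
have [Vb FVb] := HV h hp hh1 _ hM.
have diag i : 0 <= two_time h i i.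
  apply: avg_ge0 => // a; apply: sumr_ge0 => b _; rewrite mulr_ge0 ?(tf_ge0 p_trans) ?mulrn_wge0 //.
  by rewrite subnn mulr0n (evolve0 p_trans) -expr2 sqr_ge0.
apply: le_trans (ler_wpM2l (sqr_ge0 h) (sum_minmax_le _ diag)) _.
have E : h * (\sum_(i < M) \sum_(k < M - i) two_time h i (i + k)) =
    \sum_(i < M) avg w (fun a => F a * potential p F h (M - i) a) +
    \sum_(i < M) avg w (fun a => excess w p h i.+1 a * (F a * potential p F h (M - i) a)).
  by rewrite mulr_sumr -big_split; apply: eq_bigr => i _; rewrite two_time_sum.
rewrite mulrCA expr2 -[h * h * _]mulrA E [h * (_ + _)]mulrDr.
rewrite /variance_const -[leRHS]mulrA ler_pM2l // [leRHS]mulrDl; apply: lerD.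
  apply: le_trans FVb; rewrite le_eqVlt; apply/orP; left; apply/eqP; congr (h * _).
  rewrite [RHS]big_ord_recl [X in _ = X + _](_ : _ = 0) ?add0r; last first.
    by rewrite /avg big1 // => a _; rewrite /potential big_ord0 !mulr0.
  rewrite (reindex_inj rev_ord_inj) /=; apply: eq_bigr => i _.
  by rewrite /bump /= add1n subKn.
apply: (@le_trans _ _ (h * (\sum_(i < M) excess_const * sigma2))).
  rewrite ler_wpM2l // ler_sum // => i _; apply: excess_term; last first.
    by apply: Vb; rewrite (leq_trans (leq_subr _ _)).
  apply: Hk => //; apply: le_trans hM; rewrite ler_wpM2l // ler_nat.
  exact: ltnW (ltn_ord i).
rewrite sumr_const card_ord -[X in h * X]mulr_natl [leLHS]mulrA (_ : excess_const * (T * sigma2) = T * (excess_const * sigma2)); last by ring.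
have c0 : 0 <= excess_const * sigma2.
  by rewrite mulr_ge0 ?(ltW sigma2_gt0) // (le_trans _ excess_const_ge1).
by rewrite ler_wpM2r // (le_trans _ hM) // ler_wpM2l // ler_nat.
Qed.

End DiscreteVariance.

(** * Time averages of a cadlag process *)

Section IndicatorCombinations.
Local Open Scope classical_set_scope.
Local Open Scope ring_scope.
Context (disp : measure_display) (T : measurableType disp) (R : realType).
Variables (mu : {measure set T -> \bar R}) (D : set T).
Hypothesis mD : measurable D.
Hypothesis muD : (mu D < +oo)%E.
Variables (J : finType) (c : J -> R) (A : J -> set T).
Hypothesis mA : forall j, measurable (A j).

Lemma measurable_indic_comb E : measurable_fun E (fun x => \sum_j c j * \1_(A j) x).
Proof.
apply: measurable_sum => j; apply: measurable_funM; first exact: measurable_cst.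
exact: measurable_indic.
Qed.

Lemma integrable_indic_term j : mu.-integrable D (EFin \o (fun x => c j * \1_(A j) x)).
Proof.
apply: measurable_bounded_integrable => //.
  by apply: measurable_funM; [exact: measurable_cst|exact: measurable_indic].
exists `|c j|; split; first exact: num_real.
move=> y cy x _ /=; apply: le_trans (ltW cy); rewrite normrM indicE.
by case: (_ \in _); rewrite ?normr1 ?normr0 ?mulr1 ?mulr0.
Qed.

Lemma integral_indic_comb :
  (\int[mu]_(x in D) (\sum_j c j * \1_(A j) x)%:E)%E = (\sum_j c j * fine (mu (A j `&` D)))%:E.
Proof.
under eq_integral do rewrite -sumEFin.
rewrite (integral_sum mD integrable_indic_term) -sumEFin; apply: eq_bigr => j _.
have mAD : (mu (A j `&` D) < +oo)%E.
  apply: le_lt_trans muD; apply: le_measure; rewrite ?inE //; first exact: measurableI.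
transitivity (\int[mu]_(x in D) ((c j)%:E * (\1_(A j) x)%:E))%E => //.
rewrite integralZl //; last first.
  apply: (measurable_bounded_integrable mD muD (f := \1_(A j) : T -> R)); first exact: measurable_indic.
  exists 1; split => // y y1 x _ /=; apply: le_trans (ltW y1); rewrite indicE.
  by case: (_ \in _); rewrite ?normr1 ?normr0.
by rewrite integral_indic // EFinM fineK // ge0_fin_numE.
Qed.

End IndicatorCombinations.

(** * Riemann sums of bounded right-continuous functions with locally constant values *)

Section RiemannSums.
Local Open Scope classical_set_scope.
Local Open Scope ring_scope.
Variables (R : realType) (tau : R) (phi : R -> R) (K : R).
Hypothesis tau_gt0 : 0 < tau.
Hypothesis phi_bound : forall s, `|phi s| <= K.
Hypothesis phi_right : forall t, 0 <= t -> \forall s \near t^'+, phi s = phi t.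

Definition mesh (M : nat) : R := tau / M.+1%:R.

Lemma mesh_gt0 M : 0 < mesh M. Proof. by rewrite divr_gt0. Qed.

Lemma mesh_small (e : R) : 0 < e -> exists M0 : nat, forall M, (M0 <= M)%N -> mesh M < e.
Proof.
move=> e0; exists (Num.truncn (tau / e)) => M le.
rewrite /mesh ltr_pdivrMr // mulrC -ltr_pdivrMr //.
apply: lt_le_trans (truncnS_gt _) _; by rewrite ler_nat ltnS.
Qed.

Definition cell (M k : nat) : set R := [set` `[mesh M * k%:R, mesh M * k.+1%:R[].

(** Sampling at right endpoints puts the sample strictly to the right of [s], where [phi] is
    eventually equal to its value at [s]. *)
Definition step_fun (M : nat) (s : R) : R :=
  \sum_(k < M.+1) phi (mesh M *+ k.+1) * \1_(cell M k) s.

Lemma step_funE M s : 0 <= s -> s < tau ->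
  exists2 r, s < r <= s + mesh M & step_fun M s = phi r.
Proof.
move=> s0 st; have hp := mesh_gt0 M.
have q0 : 0 <= s / mesh M by rewrite divr_ge0 // ltW.
pose k := Num.truncn (s / mesh M).
have /andP[k1 k2] : k%:R <= s / mesh M < k.+1%:R by rewrite truncn_itv.
have kM : (k < M.+1)%N.
  rewrite -(ltr_nat R); apply: le_lt_trans k1 _.
  by rewrite /mesh invf_div mulrA ltr_pdivrMr // mulrC ltr_pM2l.
rewrite ler_pdivlMr // in k1; rewrite ltr_pdivrMr // in k2.
exists (mesh M *+ k.+1).
  rewrite -mulr_natr mulrC k2 /= -natr1 mulrDl mul1r lerD2r //.
rewrite /step_fun (bigD1 (Ordinal kM)) //= big1 ?addr0 => [|j jk].
  rewrite indicE mem_set ?mulr1 // /cell /= in_itv /=.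
  by rewrite mulrC k1 mulrC k2.
rewrite indicE memNset ?mulr0 // /cell /= in_itv /= => /andP[j1 j2].
case/eqP: jk; apply: val_inj => /=; apply/eqP; rewrite eqn_leq.
have a1 : mesh M * j%:R < mesh M * k.+1%:R by apply: le_lt_trans j1 _; rewrite mulrC.
have a2 : mesh M * k%:R < mesh M * j.+1%:R by apply: le_lt_trans j2; rewrite mulrC.
by move: a1 a2; rewrite !ltr_pM2l // !ltr_nat !ltnS => -> ->.
Qed.

Lemma step_fun_cvg s : 0 <= s -> s < tau -> step_fun ^~ s @ \oo --> phi s.
Proof.
move=> s0 st; have := phi_right s0; rewrite near_withinE => -[e /= e0 near_s].
apply: cvg_near_cst; have [M0 HM] := mesh_small e0.
exists M0 => // M /= M0M; have [r /andP[sr rs] ->] := step_funE M s0 st.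
apply: near_s => //=; rewrite distrC gtr0_norm ?subr_gt0 //.
by rewrite ltrBlDl (le_lt_trans rs) // ltrD2l HM.
Qed.

Lemma step_fun_bound M s : 0 <= s -> s < tau -> `|step_fun M s| <= K.
Proof. by move=> s0 st; have [r _ ->] := step_funE M s0 st. Qed.

(** At each point the step functions are eventually equal to [phi]; this yields the measurability of
    [phi] and lets dominated convergence apply. *)
Lemma Rintegral_step_cvg :
  (fun M => mesh M * \sum_(k < M.+1) phi (mesh M *+ k.+1)) @ \oo -->
  \int[@lebesgue_measure R]_(s in `[0, tau]) phi s.
Proof.
pose mu : {measure set (measurableTypeR R) -> \bar R} := @lebesgue_measure R; pose D : set R := [set` `[0, tau[].
have mD : measurable D by apply: measurable_itv.
have muI (i : interval R) : mu [set` i] = (if i.1 < i.2 then (i.2 : \bar R) - i.1 else 0)%E.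
  exact: lebesgue_measure_itv.
have muD : (mu D < +oo)%E by rewrite muI /=; case: ifP => _; rewrite ?ltry // -EFinB ltry.
have mc M (k : 'I_M.+1) : measurable (cell M k) by apply: measurable_itv.
have ms M : measurable_fun D (step_fun M) by apply: measurable_indic_comb.
have cvgD x : D x -> step_fun ^~ x @ \oo --> phi x.
  by rewrite /D /= in_itv /= => /andP[x0 xt]; apply: step_fun_cvg.
have mphi : measurable_fun D phi by apply: measurable_fun_cvg ms cvgD.
have bnd : [bounded phi x | x in D].
  exists K; split; first exact: num_real.
  by move=> y Ky x _ /=; apply: le_trans (ltW Ky).
have [iphi _ lim] : [/\ mu.-integrable D (EFin \o phi),
    [sequence (\int[mu]_(x in D) `|(step_fun n x)%:E - (phi x)%:E|)%E]_n @ \oo --> 0%E &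
    [sequence (\int[mu]_(x in D) (step_fun n x)%:E)%E]_n @ \oo --> (\int[mu]_(x in D) (phi x)%:E)%E].
  apply: (@dominated_convergence _ _ _ mu D mD (fun n => EFin \o step_fun n) (EFin \o phi) (EFin \o cst K)).
  - by move=> n; apply/measurable_EFinP; exact: ms.
  - exact/measurable_EFinP.
  - by apply/aeW => x Dx; apply: cvg_EFin; [near=> n|apply: cvgD].
  - apply: measurable_bounded_integrable => //.
    exists `|K|; split; first exact: num_real.
    by move=> y Ky x _ /=; apply: ltW.
  - apply/aeW => x n; rewrite /D /= in_itv /= => /andP[x0 xt].
    by rewrite lee_fin; apply: step_fun_bound.
rewrite -Rintegral_itv_bndo_bndc //.
have intE M : (\int[mu]_(x in D) (step_fun M x)%:E)%E = (mesh M * \sum_(k < M.+1) phi (mesh M *+ k.+1))%:E.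
  rewrite (@integral_indic_comb _ _ _ mu D mD muD _ _ _ (mc M)) mulr_sumr; congr EFin; apply: eq_bigr => k _.
  rewrite mulrC; congr (_ * _).
  have -> : cell M k `&` D = cell M k.
    apply/setIidPl => x; rewrite /cell /D /= !in_itv /= => /andP[x1 x2].
    have hp := mesh_gt0 M.
    apply/andP; split; first by apply: le_trans x1; rewrite mulr_ge0 // ltW.
    apply: lt_le_trans x2 _; apply: (@le_trans _ _ (mesh M * M.+1%:R)).
      by rewrite ler_pM2l // ler_nat.
    by rewrite /mesh divfK // pnatr_eq0.
  rewrite muI /= lte_fin ltr_pM2l ?mesh_gt0 // ltr_nat ltnSn.
  by rewrite -EFinB /= -mulrBr -natr1 addrAC subrr add0r mulr1.
have := lim; rewrite (_ : [sequence _]_n = EFin \o (fun M => mesh M * \sum_(k < M.+1) phi (mesh M *+ k.+1))); last first.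
  by apply/funext => M; rewrite /= intE.
rewrite -(fineK (integrable_fin_num (mu := mu) mD iphi)); exact: fine_cvg.
Unshelve. all: by end_near.
Qed.

End RiemannSums.

(** * Joint laws of the path and second moment of its time average *)

Section TimeAverage.
Local Open Scope classical_set_scope.
Local Open Scope ring_scope.
Context (R : realType) (l : nat) (disp : measure_display) (T : measurableType disp).
Variables (P : probability T R) (X : R -> T -> config l) (w : config l -> R).
Variable p : R -> config l -> config l -> R.
Hypothesis X_meas : forall t a, 0 <= t -> measurable [set om | X t om = a].
Hypothesis X_cadlag : forall om, cadlag (X ^~ om).
Hypothesis p_trans : transition_function p.
Hypothesis X_markov : forall (s h : R) (A : set T) (a b : config l), 0 <= s -> 0 <= h ->
  natural_filtration X s A ->
  P (A `&` [set om | X s om = a] `&` [set om | X (s + h) om = b]) =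
  (P (A `&` [set om | X s om = a]) * (p h a b)%:E)%E.
Hypothesis X_init : forall a, P [set om | X 0 om = a] = (w a)%:E.
Variables (F : config l -> R) (K tau : R).
Hypothesis F_bound : forall a, `|F a| <= K.
Hypothesis tau_gt0 : 0 < tau.

Lemma natural_filtrationT s : natural_filtration X s setT.
Proof.
have [h0 hC _] := @smallest_sigma_algebra _ setT
  [set A | exists r a, [/\ 0 <= r, r <= s & A = [set om | X r om = a]]].
by have := hC _ h0; rewrite setD0.
Qed.

Lemma law_at t b : 0 <= t -> P [set om | X t om = b] = (\sum_a w a * p t a b)%:E.
Proof.
move=> t0.
have -> : [set om | X t om = b] = \bigcup_(a in [set` index_enum (config l)])
    ([set om | X 0 om = a] `&` [set om | X (0 + t) om = b]).
  rewrite add0r; apply/seteqP; split => [om /= Xb|om]; last by case=> a _ [].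
  by exists (X 0 om); rewrite //= mem_index_enum.
rewrite measure_fin_bigcup.
- rewrite -fsbig_seq ?index_enum_uniq // -sumEFin; apply: eq_bigr => a _.
  have := X_markov a b (lexx (0 : R)) t0 (@natural_filtrationT 0); rewrite !setTI X_init => E.
  by rewrite EFinM; exact: E.
- exact: finite_seq.
- move=> a a' _ _ [om [[/= e _] [/= e' _]]].
  by rewrite -e -e'.
- by move=> a _; apply: measurableI; apply: X_meas => //; rewrite add0r.
Qed.

Lemma joint_law s h a b : 0 <= s -> 0 <= h ->
  P ([set om | X s om = a] `&` [set om | X (s + h) om = b]) =
  ((\sum_c w c * p s c a) * p h a b)%:E.
Proof.
move=> s0 h0; have := X_markov a b s0 h0 (@natural_filtrationT s).
by rewrite !setTI => ->; rewrite law_at // EFinM.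
Qed.

Definition riemann_avg (M : nat) (om : T) : R :=
  M.+1%:R^-1 * \sum_(k < M.+1) F (X (mesh tau M *+ k.+1) om).

Definition time_avg (om : T) : R :=
  tau^-1 * \int[@lebesgue_measure R]_(s in `[0, tau]) F (X s om).

Lemma riemann_avg_cvg om : riemann_avg ^~ om @ \oo --> time_avg om.
Proof.
have [cad _] := X_cadlag om.
have right t : 0 <= t -> \forall s \near t^'+, F (X s om) = F (X t om).
  by move=> t0; near=> s; congr F; near: s; apply: cad.
have lim := Rintegral_step_cvg tau_gt0 (fun s => F_bound (X s om)) right.
have -> : riemann_avg ^~ om =
    (fun M => tau^-1 * (mesh tau M * \sum_(k < M.+1) F (X (mesh tau M *+ k.+1) om))).
  apply/funext => M; rewrite /riemann_avg mulrA; congr (_ * _).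
  by rewrite {1}/mesh mulKf // lt0r_neq0.
exact: (cvgM (cvg_cst (tau^-1)) lim).
Unshelve. all: by end_near.
Qed.

Lemma riemann_avg_bound M om : `|riemann_avg M om| <= K.
Proof.
rewrite /riemann_avg normrM ger0_norm ?invr_ge0 // mulrC ler_pdivrMr //.
apply: le_trans (ler_norm_sum _ _ _) _; apply: le_trans (ler_sum _ (fun k _ => F_bound _)) _.
by rewrite sumr_const card_ord mulr_natr.
Qed.

Lemma riemann_avg_meas M : measurable_fun setT (riemann_avg M).
Proof.
have -> : riemann_avg M = fun om => \sum_(ka : 'I_M.+1 * config l)
    (M.+1%:R^-1 * F ka.2) * \1_[set om | X (mesh tau M *+ ka.1.+1) om = ka.2] om.
  apply/funext => om; rewrite /riemann_avg mulr_sumr -(pair_bigA _ (fun (k : 'I_M.+1) a => (M.+1%:R^-1 * F a) * \1_[set om | X (mesh tau M *+ k.+1) om = a] om)).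
  apply: eq_bigr => k _ /=; rewrite (bigD1 (X (mesh tau M *+ k.+1) om)) //= indicE mem_set // mulr1 big1 ?addr0 // => a ne.
  by rewrite indicE memNset ?mulr0 //= => e; rewrite e eqxx in ne.
apply: measurable_indic_comb => -[k a] /=; apply: X_meas.
by rewrite mulrn_wge0 // ltW // mesh_gt0.
Qed.

(** The square is a finite combination of indicators of joint events at two grid times, whose
    probabilities come from [joint_law] with the earlier time first. *)
Lemma riemann_avg_sq M :
  (\int[P]_om ((riemann_avg M om) ^+ 2)%:E)%E =
  (M.+1%:R^-1 ^+ 2 * \sum_(i < M.+1) \sum_(j < M.+1)
     two_time w p F (mesh tau M) (minn i j) (maxn i j))%:E.
Proof.
pose h := mesh tau M; have h0 : 0 < h by apply: mesh_gt0.
pose t (k : 'I_M.+1) := h *+ k.+1.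
have t0 k : 0 <= t k by rewrite mulrn_wge0 // ltW.
pose J := ('I_M.+1 * 'I_M.+1 * (config l * config l))%type.
pose A (q : J) := [set om | X (t q.1.1) om = q.2.1] `&` [set om | X (t q.1.2) om = q.2.2].
pose c (q : J) := M.+1%:R^-1 ^+ 2 * (F q.2.1 * F q.2.2).
have mA q : measurable (A q) by apply: measurableI; apply: X_meas.
have E om : (riemann_avg M om) ^+ 2 = \sum_q c q * \1_(A q) om.
  rewrite exprMn [X in _ * X]expr2 big_distrlr /= mulr_sumr.
  rewrite -(pair_bigA _ (fun ij ab => c (ij, ab) * \1_(A (ij, ab)) om)) /=.
  rewrite -(pair_bigA _ (fun i j => \sum_ab c ((i, j), ab) * \1_(A ((i, j), ab)) om)) /=.
  apply: eq_bigr => i _; rewrite mulr_sumr; apply: eq_bigr => j _.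
  rewrite (bigD1 (X (t i) om, X (t j) om)) //= indicE mem_set // mulr1 big1 ?addr0 // => -[a b] /= ne.
  rewrite indicE memNset ?mulr0 //= /A /= => -[e1 e2].
  by rewrite -e1 -e2 eqxx in ne.
under eq_integral do rewrite E.
have PT : (P setT < +oo)%E by rewrite probability_setT ltry.
rewrite (integral_indic_comb measurableT PT c mA).
congr EFin.
rewrite mulr_sumr -(pair_bigA _ (fun ij ab => c (ij, ab) * fine (P (A (ij, ab) `&` setT)))) /=.
rewrite -(pair_bigA _ (fun i j => \sum_ab c ((i, j), ab) * fine (P (A ((i, j), ab) `&` setT)))) /=.
apply: eq_bigr => i _; rewrite mulr_sumr; apply: eq_bigr => j _.
rewrite /c /=; under eq_bigr do rewrite -mulrA setIT.
rewrite -mulr_sumr; congr (_ * _).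
have ordered (i' j' : 'I_M.+1) : (i' <= j')%N ->
    \sum_(ab : config l * config l) F ab.1 * F ab.2 *
      fine (P ([set om | X (t i') om = ab.1] `&` [set om | X (t j') om = ab.2])) =
    two_time w p F h i' j'.
  move=> ij; have hj : 0 <= h *+ (j' - i') by rewrite mulrn_wge0 // ltW.
  have tj : t j' = t i' + h *+ (j' - i') by rewrite /t -mulrnDr; congr (_ *+ _); lia.
  rewrite tj -(pair_bigA _ (fun a b => F a * F b * fine (P ([set om | X (t i') om = a] `&` [set om | X (t i' + h *+ (j' - i')) om = b])))) /=.
  transitivity (\sum_a (\sum_c w c * p (t i') c a) * (F a * evolve p (h *+ (j' - i')) F a)).
    apply: eq_bigr => a _; rewrite /evolve !mulr_sumr; apply: eq_bigr => b _.
    by rewrite joint_law //=; ring.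
  under eq_bigr do rewrite mulr_suml.
  rewrite exchange_big; apply: eq_bigr => b _ /=; rewrite mulr_sumr; apply: eq_bigr => a _.
  by rewrite -mulrA.
have [ij|/ltnW ji] := leqP i j; first exact: ordered.
rewrite -(ordered j i ji) (reindex_inj (h := fun ab : config l * config l => (ab.2, ab.1))) /=; last first.
  by move=> [a b] [a' b'] /= [-> ->].
by apply: eq_bigr => -[a b] _ /=; rewrite setIC (mulrC (F b)).
Qed.

(** The Riemann averages are bounded by K and converge on every path, so their second moments
    converge and the bound passes to the limit. *)
Lemma time_avg_sq_le (c : R) :
  (exists M0, forall M, (M0 <= M)%N ->
     M.+1%:R^-1 ^+ 2 * (\sum_(i < M.+1) \sum_(j < M.+1)
       two_time w p F (mesh tau M) (minn i j) (maxn i j)) <= c) ->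
  ('E_P[fun om => ((time_avg om) ^+ 2)%R] <= c%:E)%E.
Proof.
move=> [M0 HM]; rewrite unlock.
have cvg2 om : (fun M => (riemann_avg M om) ^+ 2) @ \oo --> (time_avg om) ^+ 2.
  by apply: cvgM; apply: riemann_avg_cvg.
have m2 M : measurable_fun setT (fun om => (riemann_avg M om) ^+ 2).
  by apply: measurable_funX; apply: riemann_avg_meas.
have mt : measurable_fun setT (fun om => (time_avg om) ^+ 2).
  by apply: measurable_fun_cvg m2 _ => om _; apply: cvg2.
have PT : (P setT < +oo)%E by rewrite probability_setT ltry.
have [_ _ lim] : [/\ P.-integrable setT (EFin \o (fun om => (time_avg om) ^+ 2)),
    [sequence (\int[P]_om `|((riemann_avg n om) ^+ 2)%:E - ((time_avg om) ^+ 2)%:E|)%E]_n @ \oo --> 0%E &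
    [sequence (\int[P]_om ((riemann_avg n om) ^+ 2)%:E)%E]_n @ \oo --> (\int[P]_om ((time_avg om) ^+ 2)%:E)%E].
  apply: (@dominated_convergence _ _ _ P setT measurableT (fun n om => ((riemann_avg n om) ^+ 2)%:E)
     (fun om => ((time_avg om) ^+ 2)%:E) (EFin \o cst (K ^+ 2))).
  - by move=> n; apply/measurable_EFinP; exact: m2.
  - by apply/measurable_EFinP; exact: mt.
  - by apply/aeW => om _; apply: cvg_EFin; [near=> n|apply: cvg2].
  - apply: measurable_bounded_integrable => //.
    exists `|K ^+ 2|; split; first exact: num_real.
    by move=> y Ky x _ /=; apply: ltW.
  - apply/aeW => om n _; rewrite /= lee_fin ger0_norm ?sqr_ge0 //.
    rewrite -real_normK ?num_real // lerXn2r ?nnegrE ?riemann_avg_bound //.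
    exact: le_trans (normr_ge0 _) (riemann_avg_bound n om).
rewrite -(cvg_lim _ lim) //; apply: lime_le; first by apply/cvg_ex; eexists; exact: lim.
exists M0 => // M /= M0M; rewrite riemann_avg_sq lee_fin; exact: HM.
Unshelve. all: by end_near.
Qed.

End TimeAverage.

(** * Canonical measures and powers of N *)

Section CanonicalMeasure.
Variables (R : realType) (l : nat).
Implicit Types (eta zeta : config l) (sigma : R).

Lemma sum_spin eta : \sum_x spin R (eta x) = 2 * #|[set x | eta x]|%:R - l.+1%:R.
Proof.
rewrite (eq_bigr (fun x => 2 * (eta x)%:R - 1)); last first.
  by move=> x _; rewrite /spin; case: (eta x) => /=; ring.
rewrite sumrB -mulr_sumr sumr_const card_ord; congr (2 * _ - _).
by rewrite -natr_sum -big_mkcond sum1dep_card.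
Qed.

Definition magnetization eta : R := (l.+1%:R)^-1 * \sum_x spin R (eta x).

Lemma magnetization_eq eta zeta :
  (magnetization eta == magnetization zeta) = (#|[set x | eta x]| == #|[set x | zeta x]|).
Proof.
rewrite /magnetization (inj_eq (mulfI _)) ?invr_eq0 ?pnatr_eq0 // !sum_spin.
by rewrite (inj_eq (addIr _)) (inj_eq (mulfI _)) ?pnatr_eq0 // eqr_nat.
Qed.

Lemma magnetization_itv eta : -1 <= magnetization eta <= 1.
Proof.
have l0 : 0 < l.+1%:R :> R by rewrite ltr0n.
have c : (#|[set x | eta x]| <= l.+1)%N by rewrite -[X in (_ <= X)%N]card_ord max_card.
rewrite /magnetization sum_spin mulrC ler_pdivlMr // ler_pdivrMr //.
move: c; rewrite -(ler_nat R) => c; have := ler0n R #|[set x | eta x]|.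
move: (l.+1%:R : R) (#|_|%:R : R) c l0 => a b; lra.
Qed.

Lemma in_hyperplane sigma eta : (eta \in hyperplane l sigma) = (magnetization eta == sigma).
Proof. by rewrite inE. Qed.

Lemma canonical_pmf_ge0 sigma eta : 0 <= canonical_pmf sigma eta.
Proof. by rewrite divr_ge0. Qed.

Lemma canonical_pmf_count sigma eta zeta :
  #|[set x | eta x]| = #|[set x | zeta x]| -> canonical_pmf sigma eta = canonical_pmf sigma zeta.
Proof.
move=> e; have /eqP m : magnetization eta == magnetization zeta by rewrite magnetization_eq e.
by rewrite /canonical_pmf !in_hyperplane m.
Qed.

Lemma canonical_pmf_sum sigma : hyperplane l sigma != finset.set0 ->
  \sum_(eta : config l) canonical_pmf sigma eta = 1.
Proof.
move=> ne; rewrite -mulr_suml -natr_sum -big_mkcond sum1_card divff //.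
by rewrite pnatr_eq0 -lt0n card_gt0.
Qed.

(** Levels of the magnetization are levels of the particle number, and an empty level gives an empty
    sum. *)
Lemma slice_sums_of_canonical (f : config l -> R) :
  (forall sigma, -1 <= sigma <= 1 -> hyperplane l sigma != finset.set0 ->
     canonical_expectation sigma f = 0) ->
  forall k : nat, \sum_(eta : config l | #|[set x | eta x]| == k) f eta = 0.
Proof.
move=> f0 k.
case: (pickP (fun eta : config l => #|[set x | eta x]| == k)) => [xi /eqP xk|no]; last by rewrite big_pred0.
have xin : xi \in hyperplane l (magnetization xi) by rewrite in_hyperplane.
have ne : hyperplane l (magnetization xi) != finset.set0 by apply/set0Pn; exists xi.
have := f0 _ (magnetization_itv xi) ne; rewrite /canonical_expectation.
rewrite (eq_bigr (fun eta => (#|hyperplane l (magnetization xi)|%:R)^-1 *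
    (if #|[set x | eta x]| == k then f eta else 0))); last first.
  move=> eta _; rewrite /canonical_pmf in_hyperplane magnetization_eq xk.
  by case: ifP => _; rewrite ?mul1r // !mul0r mulr0.
rewrite -mulr_sumr -big_mkcond => /eqP; rewrite mulf_eq0 invr_eq0 pnatr_eq0.
by rewrite -[_ == 0%N]negbK -lt0n card_gt0 ne /= => /eqP.
Qed.

End CanonicalMeasure.

Lemma exponent_first (R : realType) (x : R) : x <= 1 / 9 -> 1 / 3 + x - 4 / 3 <= 0.
Proof. by move=> h; lra. Qed.

(** The left side is 3 x - 1/3; this fixes the threshold 1/9. *)
Lemma exponent_second (R : realType) (x : R) :
  x <= 1 / 9 -> (1 / 3 + x) * 3%:R + - (4 / 3) * 4%:R + 4%:R <= 0.
Proof. by move=> h; lra. Qed.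

Section Scaling.
Variables (R : realType) (N : nat).
Hypothesis N_gt0 : (0 < N)%N.
Notation nu := (N%:R : R).

Lemma powR_nat_le1 (a : R) : a <= 0 -> nu `^ a <= 1.
Proof. by move=> a0; rewrite -[leRHS](powRr0 nu) ler_powR // ler1n. Qed.

Lemma powR_nat_ge1 (a : R) : 0 <= a -> 1 <= nu `^ a.
Proof. by move=> a0; rewrite -[leLHS](powRr0 nu) ler_powR // ler1n. Qed.

Lemma powR_nat_D (a b : R) : nu `^ a * nu `^ b = nu `^ (a + b).
Proof. by rewrite -powRD //; apply/implyP => _; rewrite pnatr_eq0 -lt0n. Qed.

Lemma powR_nat_X (a : R) k : (nu `^ a) ^+ k = nu `^ (a * k%:R).
Proof. by rewrite powRrM powR_mulrn // powR_ge0. Qed.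

Variables (e tau ereg KL Kt : R).
Hypothesis e_ge0 : 0 <= e.
Hypothesis tau_ge0 : 0 <= tau.
Hypothesis KL_ge0 : 0 <= KL.
Hypothesis Kt_ge0 : 0 <= Kt.
Hypothesis ereg_le : ereg <= 1 / 9.
Hypothesis e_le : e <= KL * nu `^ (1 / 3 + ereg).
Hypothesis tau_le : tau <= Kt * nu `^ (- (4 / 3)).

Lemma scaling_first : e * (2 * tau) <= 2 * KL * Kt.
Proof.
have h := ler_pM e_ge0 tau_ge0 e_le tau_le.
have : nu `^ (1 / 3 + ereg) * nu `^ (- (4 / 3)) <= 1.
  by rewrite powR_nat_D; apply/powR_nat_le1/exponent_first.
move=> /(ler_wpM2l (mulr_ge0 KL_ge0 Kt_ge0)); rewrite mulr1.
move: h; set x := nu `^ _; set y := nu `^ _ => h1 h2.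
have -> : 2 * KL * Kt = 2 * (KL * Kt) by ring.
have -> : e * (2 * tau) = 2 * (e * tau) by ring.
rewrite ler_pM2l //; apply: le_trans h1 _; apply: le_trans h2.
by rewrite le_eqVlt; apply/orP; left; apply/eqP; ring.
Qed.

(* The exponent of N is 1 + 3 ereg - 16/3 + 4, which is at most 0 when ereg <= 1/9. *)
Lemma scaling_second : e ^+ 3 * (2 * tau) ^+ 4 * nu ^+ 4 <= 16 * KL ^+ 3 * Kt ^+ 4.
Proof.
have e3 : e ^+ 3 <= KL ^+ 3 * nu `^ ((1 / 3 + ereg) * 3%:R).
  by rewrite -powR_nat_X -exprMn lerXn2r ?nnegrE // mulr_ge0 ?powR_ge0.
have t4 : tau ^+ 4 <= Kt ^+ 4 * nu `^ (- (4 / 3) * 4%:R).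
  by rewrite -powR_nat_X -exprMn lerXn2r ?nnegrE // mulr_ge0 ?powR_ge0.
have h := ler_pM (exprn_ge0 3 e_ge0) (exprn_ge0 4 tau_ge0) e3 t4.
have n4 : nu ^+ 4 = nu `^ 4%:R by rewrite powR_mulrn.
have : nu `^ ((1 / 3 + ereg) * 3%:R) * nu `^ (- (4 / 3) * 4%:R) * nu ^+ 4 <= 1.
  by rewrite n4 !powR_nat_D; apply/powR_nat_le1/exponent_second.
move=> /(ler_wpM2l (mulr_ge0 (exprn_ge0 3 KL_ge0) (exprn_ge0 4 Kt_ge0))); rewrite mulr1.
move: h => /(ler_wpM2r (exprn_ge0 4 (ler0n R N))).
set x := nu `^ _; set y := nu `^ _; set z := nu ^+ 4 => h1 h2.
have -> : e ^+ 3 * (2 * tau) ^+ 4 * z = 16 * (e ^+ 3 * tau ^+ 4 * z) by ring.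
have -> : 16 * KL ^+ 3 * Kt ^+ 4 = 16 * (KL ^+ 3 * Kt ^+ 4) by ring.
rewrite ler_pM2l //; apply: le_trans h1 _; apply: le_trans h2.
by rewrite le_eqVlt; apply/orP; left; apply/eqP; ring.
Qed.

End Scaling.

Section Blocks.
Variables (R : realType) (l n : nat) (I : 'I_n -> {set 'I_l.+1}).
Hypothesis I_interval : forall i, is_subinterval (I i).
Hypothesis I_disj : forall i j, i != j -> (I i :&: I j)%SET = finset.set0.

(** Intervals are nonempty, and choosing a site in each is injective by disjointness. *)
Lemma num_blocks : (n <= l.+1)%N.
Proof.
have ne i : {x | x \in I i}.
  by apply/sigW; have := interval_gt0 (I_interval i); rewrite card_gt0 => /set0Pn.
pose g i := sval (ne i).
have gI i : g i \in I i by apply: (svalP (ne i)).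
have ginj : injective g.
  move=> i j e; apply/eqP; apply: contraT => ij.
  have := finset.in_setI (g i) (I i) (I j).
  by rewrite (I_disj ij) gI {2}e gI finset.in_set0.
by have := leq_card g ginj; rewrite !card_ord.
Qed.

Lemma max_size2_ge1 : (0 < n)%N -> 1 <= max_size2 R I.
Proof.
move=> n0; rewrite /max_size2 (ler_nat R 1).
apply: leq_trans (leq_bigmax (Ordinal n0)).
by rewrite expn_gt0 (interval_gt0 (I_interval _)).
Qed.

End Blocks.

(** * Choice of the constants for block averages *)

Section TwoTimeBound.
Variables (R : realType) (B KL Kt K : R).

(** The leading 2 is the ratio of the horizon 2 tau to tau; the arguments of [variance_const] are
    the bounds of the two scaling lemmas for that horizon. *)
Definition bound_const : R :=
  2 * variance_const B (2 * KL * Kt) (16 * KL ^+ 3 * Kt ^+ 4) * K ^+ 2.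

Hypothesis KL_ge0 : 0 <= KL.
Hypothesis Kt_ge0 : 0 <= Kt.
Hypothesis K_gt0 : 0 < K.

Lemma variance_const_gt0 (K1 K2 : R) : 0 <= K1 -> 0 <= K2 -> 0 < variance_const B K1 K2.
Proof.
move=> K10 K20; have g0 : 0 <= growth B K1 by apply: expR_ge0.
have := mulr_ge0 (mulr_ge0 (sqr_ge0 B) K10) g0.
have := excess_const_ge1 B K1 K20; rewrite /variance_const; lra.
Qed.

Lemma bound_const_gt0 : 0 < bound_const.
Proof.
rewrite /bound_const mulr_gt0 ?exprn_gt0 // mulr_gt0 // variance_const_gt0 //.
  by rewrite !mulr_ge0.
by apply: mulr_ge0; [apply: mulr_ge0|]; rewrite // exprn_ge0.
Qed.

Variables (N l n : nat) (d : (int -> bool) -> R) (ereg tau sigma : R).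
Variables (f : 'I_n -> config l -> R) (I : 'I_n -> {set 'I_l.+1}).
Variable p : R -> config l -> config l -> R.
Hypothesis N_gt0 : (0 < N)%N.
Hypothesis n_gt0 : (0 < n)%N.
Hypothesis d_bound : forall eta, `|d eta| <= B.
Hypothesis ereg_le : ereg <= 1 / 9.
Hypothesis l_le : l.+1%:R <= KL * N%:R `^ (1 / 3 + ereg).
Hypothesis tau_gt0 : 0 < tau.
Hypothesis tau_le : tau <= Kt * N%:R `^ (- (4 / 3)).
Hypothesis f_canonical : forall i sg, -1 <= sg <= 1 -> hyperplane l sg != finset.set0 ->
  canonical_expectation sg (f i) = 0.
Hypothesis f_bound : forall i eta, `|f i eta| <= K.
Hypothesis I_interval : forall i, is_subinterval (I i).
Hypothesis I_disj : forall i j, i != j -> (I i :&: I j)%SET = finset.set0.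
Hypothesis f_dep : forall i, depends_on (I i) (f i).
Hypothesis sigma_ne : hyperplane l sigma != finset.set0.
Hypothesis p_trans : transition_function p.
Hypothesis p_gen : has_generator p (@generator R N l d).

Lemma two_time_bound : exists M0 : nat, forall M, (M0 <= M)%N ->
  M.+1%:R^-1 ^+ 2 * (\sum_(i < M.+1) \sum_(j < M.+1)
    two_time (canonical_pmf sigma) p (block_avg f) (mesh tau M) (minn i j) (maxn i j)) <=
  bound_const * (N%:R ^- 2 * tau^-1 * n%:R^-1 * max_size2 R I).
Proof.
set w := canonical_pmf sigma; set nu : R := N%:R; set e : R := l.+1%:R.
have nu0 : 0 < nu by rewrite ltr0n.
have nn0 : 0 < n%:R :> R by rewrite ltr0n.
have w0 := @canonical_pmf_ge0 R l sigma.
have wc := @canonical_pmf_count R l sigma.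
have w1 := canonical_pmf_sum sigma_ne.
have fc i : centred (I i) (f i).
  by apply: centred_of_slice_sums => //; apply: slice_sums_of_canonical => sg; apply: f_canonical.
pose m2 := max_size2 R I.
have m1 : 1 <= m2 by apply: max_size2_ge1.
pose s2 := K ^+ 2 * m2 / (n%:R * nu ^+ 2).
have s20 : 0 < s2 by rewrite divr_gt0 ?mulr_gt0 ?exprn_gt0 // (lt_le_trans ltr01).
have Fb := block_avg_bound n_gt0 f_bound.
have Fh u : avg w (fun eta => block_avg f eta * u eta) ^+ 2 <= nu ^+ 2 * s2 * dirichlet w u.
  have -> : nu ^+ 2 * s2 = K ^+ 2 * m2 / n%:R by rewrite /s2; field; rewrite !lt0r_neq0.
  exact: block_avg_hminus1.
have T0 : 0 < 2 * tau by rewrite mulr_gt0.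
have eT := scaling_first N_gt0 (ler0n R l.+1) (ltW tau_gt0) KL_ge0 Kt_ge0 ereg_le l_le tau_le.
have s2nd := scaling_second N_gt0 (ler0n R l.+1) (ltW tau_gt0) KL_ge0 Kt_ge0 ereg_le l_le tau_le.
rewrite -/e -/nu in eT s2nd.
set K2 := 16 * KL ^+ 3 * Kt ^+ 4 in s2nd.
have K20 : 0 <= K2 by apply: mulr_ge0; [apply: mulr_ge0|]; rewrite // exprn_ge0.
have F4 : avg w (fun eta => block_avg f eta ^+ 4) <= K ^+ 4 / n%:R.
  apply: (@le_trans _ _ (avg w (fun eta => K ^+ 2 * block_avg f eta ^+ 2))).
    apply: avg_le => // eta; rewrite (_ : _ ^+ 4 = block_avg f eta ^+ 2 * block_avg f eta ^+ 2); last by ring.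
    rewrite ler_wpM2r ?sqr_ge0 // -real_normK ?num_real // lerXn2r ?nnegrE ?(ltW K_gt0) //.
  rewrite avgZ (_ : K ^+ 4 / n%:R = K ^+ 2 * (K ^+ 2 / n%:R)); last by ring.
  by rewrite ler_wpM2l ?sqr_ge0 // (block_avg_sq w0 wc w1 n_gt0 f_bound I_disj).
have Fq : (e * (2 * tau)) ^+ 2 * (2 * tau) ^+ 2 * avg w (fun eta => block_avg f eta ^+ 4) <= K2 * s2 ^+ 2.
  have a0 : 0 <= (e * (2 * tau)) ^+ 2 * (2 * tau) ^+ 2 by rewrite mulr_ge0 ?sqr_ge0.
  apply: le_trans (ler_wpM2l a0 F4) _.
  (* The square of [s2] carries 1/n^2 but [F4] only 1/n; n <= e supplies the missing factor and
     raises e^2 to the e^3 of [scaling_second]. *)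
  have nle : n%:R <= e by rewrite ler_nat; apply: num_blocks I_disj.
  have c0 : 0 <= K ^+ 4 / (n%:R ^+ 2 * nu ^+ 4) by rewrite divr_ge0 ?exprn_ge0 ?mulr_ge0 ?exprn_ge0 ?(ltW K_gt0).
  have -> : (e * (2 * tau)) ^+ 2 * (2 * tau) ^+ 2 * (K ^+ 4 / n%:R) =
     K ^+ 4 / (n%:R ^+ 2 * nu ^+ 4) * (n%:R * (e ^+ 2 * (2 * tau) ^+ 4 * nu ^+ 4)).
    by move: (e) => e0; field; rewrite !lt0r_neq0.
  have -> : K2 * s2 ^+ 2 = K ^+ 4 / (n%:R ^+ 2 * nu ^+ 4) * (K2 * m2 ^+ 2).
    by rewrite /s2; field; rewrite !lt0r_neq0.
  apply: (ler_wpM2l c0); apply: (@le_trans _ _ K2); last first.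
    by rewrite -[leLHS]mulr1 ler_wpM2l // -(expr1n _ 2) lerXn2r ?nnegrE // (le_trans ler01).
  apply: le_trans s2nd; rewrite (_ : e ^+ 3 * _ * _ = e * (e ^+ 2 * (2 * tau) ^+ 4 * nu ^+ 4)); last first.
    by move: (e) => e0; ring.
  by apply: ler_wpM2r nle; rewrite !mulr_ge0 ?exprn_ge0 ?mulr_ge0 ?(ltW tau_gt0) ?ler0n.
have [h0 h00 H] := discrete_variance w0 wc w1 N_gt0 d_bound p_trans p_gen Fb s20 Fh T0 eT K20 Fq.
have [M0 HM] := mesh_small tau h00; exists M0 => M M0M.
have hp := mesh_gt0 tau_gt0 M; have := H _ hp (HM M M0M) M.+1.
have M1 : 0 < M.+1%:R :> R by rewrite ltr0n.
(* M + 1 samples require M + 2 steps in [discrete_variance], which overshoots tau; hence the horizon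
   2 tau. *)
have -> : mesh tau M * M.+2%:R <= 2 * tau.
  rewrite /mesh mulrAC ler_pdivrMr // mulrC -mulrA [tau * _]mulrC mulrA ler_wpM2r ?(ltW tau_gt0) //.
  by rewrite -natrM ler_nat mul2n -addnn addSn ltnS leq_addl.
move=> /(_ isT); set S := \sum_(i < M.+1) _ => HS.
have t20 : 0 <= tau^-1 ^+ 2 by apply: sqr_ge0.
have := ler_wpM2l t20 HS.
rewrite (_ : tau^-1 ^+ 2 * (mesh tau M ^+ 2 * S) = M.+1%:R^-1 ^+ 2 * S); last first.
  by rewrite /mesh mulrA -exprMn mulrA mulVf ?mul1r // lt0r_neq0.
move/le_trans; apply; rewrite le_eqVlt; apply/orP; left; apply/eqP.
rewrite /bound_const -/K2 /s2 -/m2; move: (variance_const _ _ _) => vc.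
by rewrite -/nu; field; rewrite !lt0r_neq0.
Qed.

End TwoTimeBound.

Local Open Scope classical_set_scope.
Local Open Scope ring_scope.

Theorem proposition8p4 (R : realType) :
  exists2 ereg0 : R, 0 < ereg0 &
  forall ereg : R, 0 < ereg -> ereg <= ereg0 ->
  forall d : (int -> bool) -> R, local_fun d -> uniformly_bounded d ->
  forall KL Kf Ktau delta : R, 0 < delta ->
  exists2 C : R, 0 < C &
  forall (N l : nat), (l < N)%N ->
    l.+1%:R <= KL * N%:R `^ (1 / 3 + ereg) ->
  forall (n : nat) (f : 'I_n -> config l -> R) (I : 'I_n -> {set 'I_l.+1}),
    (0 < n)%N ->
    (forall (i : 'I_n) (sigma : R), -1 <= sigma <= 1 ->
       hyperplane l sigma != finset.set0 ->
       canonical_expectation sigma (f i) = 0) ->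
    (forall (i : 'I_n) (eta : config l), `|f i eta| <= Kf) ->
    (forall i : 'I_n, is_subinterval (I i)) ->
    (forall i j : 'I_n, i != j -> (I i :&: I j)%SET = finset.set0) ->
    (forall (i : 'I_n) (eta eta' : config l),
       (forall z : 'I_l.+1, z \in I i -> eta z = eta' z) -> f i eta = f i eta') ->
  forall tau : R, 0 < tau -> tau <= Ktau * N%:R `^ (- (4 / 3)) ->
  forall (disp : measure_display) (T : measurableType disp)
    (P : probability T R) (X : R -> T -> config l),
    markov_process P (generator N d) X ->
  forall sigma : R, -1 <= sigma <= 1 -> hyperplane l sigma != finset.set0 ->
    (forall eta : config l,
       P [set w | X 0 w = eta] = (canonical_pmf sigma eta)%:E) ->
  ('E_P[fun w : T =>
     ((tau^-1 * \int[@lebesgue_measure R]_(s in `[0, tau])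
        (n%:R^-1 * \sum_(i < n) f i (X s w))) ^+ 2)%R]
   <= (C * (N%:R `^ delta * N%:R ^- 2 * tau^-1 * n%:R^-1 *
            (\max_(i < n) #|I i| ^ 2)%N%:R))%:E)%E.
Proof.
exists (1 / 9); first by rewrite divr_gt0.
move=> ereg _ ereg_le d _ [B d_bound] KL Kf Ktau delta delta_gt0.
(* The given constants are arbitrary reals; absolute values restore their signs, and the added 1
   keeps the final constant positive. *)
have K_gt0 : 0 < `|Kf| + 1 by rewrite ltr_wpDl.
exists (bound_const B `|KL| `|Ktau| (`|Kf| + 1)); first exact: bound_const_gt0.
move=> N l lN l_le n f I n_gt0 f_can f_bound I_int I_disj f_dep tau tau_gt0 tau_le.
move=> disp T P X [X_meas X_cadlag [p [p_trans p_gen X_markov]]] sigma _ sigma_ne X_init.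
have N_gt0 : (0 < N)%N by apply: leq_ltn_trans lN.
have l_le' : l.+1%:R <= `|KL| * N%:R `^ (1 / 3 + ereg).
  by apply: le_trans l_le _; rewrite ler_wpM2r ?powR_ge0 ?ler_norm.
have tau_le' : tau <= `|Ktau| * N%:R `^ (- (4 / 3)).
  by apply: le_trans tau_le _; rewrite ler_wpM2r ?powR_ge0 ?ler_norm.
have f_bound' i eta : `|f i eta| <= `|Kf| + 1.
  by apply: le_trans (f_bound i eta) _; rewrite (le_trans (ler_norm _)) // lerDl.
have block_bound := block_avg_bound n_gt0 f_bound'.
apply: (time_avg_sq_le (F := block_avg f) X_meas X_cadlag X_markov X_init block_bound tau_gt0).
have [M0 H] := two_time_bound (normr_ge0 KL) (normr_ge0 Ktau) K_gt0 N_gt0 n_gt0 d_bound ereg_le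
  l_le' tau_gt0 tau_le' f_can f_bound' I_int I_disj f_dep sigma_ne p_trans p_gen.
exists M0 => M M0M; apply: le_trans (H M M0M) _.
rewrite ler_wpM2l //; first by apply/ltW/bound_const_gt0.
(* As N >= 1 and delta > 0, the factor N^delta is at least 1 and can be inserted on the right. *)
rewrite -!mulrA ler_peMl ?powR_nat_ge1 ?(ltW delta_gt0) //.
by rewrite mulr_ge0 ?invr_ge0 ?exprn_ge0 // mulr_ge0 ?invr_ge0 ?(ltW tau_gt0) // mulr_ge0 ?invr_ge0.
Qed.
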